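(* Suppose that the assumption on $\alpha,\beta$, the diffusion-coefficient assumption on $\sigma$ (with $\sigma^2(q)=D(q)$ for $q\ge M$) and the initial-condition assumption on $\mathfrak{C}_0$, all given in the context, hold true. Denote by $\mathfrak{C}\in\mathcal{C}^\infty(\mathbb{R}_+\times\mathbb{R})$ the (unique classical, smooth and bounded) solution of $$\frac{\partial \mathfrak{C}}{\partial t} = \frac12\sigma^2(q)\frac{\partial^2\mathfrak{C}}{\partial q^2},\qquad \mathfrak{C}(0,q)=\mathfrak{C}_0(q).$$ Fix an integer $n_0\ge M$ and the time $t^*_{n_0}=G(n_0)$. Consider the sequence of smooth functions $\widehat{C}=(\widehat{C}_{n_0},\dots,\widehat{C}_n,\dots)$ defined, for all $n\ge n_0$, by $$\forall t\in[0,t^*_{n_0}],\qquad \widehat{C}_n(t)=\mathfrak{C}(t,Q(t,n)).$$ Then there exists a non-negative function $K\in\mathcal{C}^0(\mathbb{R}_+)$ such that, for all $n\ge n_0+1$, $$\forall t\in[0,t^*_{n_0}],\qquad \frac{d\widehat{C}_n}{dt}=\beta_{n-1}\widehat{C}_{n-1}C_1-(\beta_nC_1+\alpha_n)\widehat{C}_n+\alpha_{n+1}\widehat{C}_{n+1}+R_n,$$ where the remainder $R_n\in\mathcal{C}^0([0,t^*_{n_0}],\mathbb{R})$ satisfies $$\forall t\in[0,t^*_{n_0}],\ \forall n\ge n_0+1,\qquad |R_n(t)|\le\frac{K(t)}{n^{\gamma/2}}.$$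
   Context: $\mathbb{R}_+=[0,+\infty)$. $C_1\ge 0$ is a fixed real number. Assumption on $\alpha,\beta$: $\alpha,\beta:\mathbb{R}_+\to\mathbb{R}_+$ are smooth, non-decreasing and non-negative. There exists $0\le\gamma\le1/2$ such that, as $x\to+\infty$, $\alpha^{(k)}(x)=\mathrm{O}(x^{\gamma-k})$ and $\beta^{(k)}(x)=\mathrm{O}(x^{\gamma-k})$ for all $k\in\{0,1,2\}$. Finally, there exist $M,K_+,K_->0$ (depending on $C_1$) such that, on $[M,+\infty)$, the function $F=\beta C_1-\alpha$ is positive and increasing, and $K_-x^\gamma\le F(x)\le K_+x^\gamma$ for all $x\ge M$. For integers $n$, $\alpha_n=\alpha(n)$ and $\beta_n=\beta(n)$. Notation: $F(x)=\beta(x)C_1-\alpha(x)$, $D(x)=\beta(x)C_1+\alpha(x)$. For $x\ge M$, $G(x)=\int_M^x \frac{dy}{F(y)}$; $G$ is an increasing bijection from $[M,+\infty)$ to $[0,+\infty)$ with inverse $G^{-1}:[0,+\infty)\to[M,+\infty)$. $Q(t,x)=G^{-1}(G(x)-t)$ for $x\ge M$ and $0\le t\le G(x)$. Diffusion-coefficient assumption: $\sigma$ is a smooth positive function on $\mathbb{R}$ with bounded derivatives. Moreover $\sigma(q)=\sigma_0(q)\sigma_{\mathrm b}(q)$, where $\sigma_0(q)=|q|^{\gamma/2}$ for $|q|\ge1$ (here $\gamma\in[0,1/2]$ is the same exponent as the one for which $\alpha^{(k)}(x),\beta^{(k)}(x)=\mathrm{O}(x^{\gamma-k})$ for $k\in\{0,1,2\}$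 and $K_-x^\gamma\le F(x)\le K_+x^\gamma$ for $x\ge M$), and $\sigma_{\mathrm b}$ is a bounded smooth function with bounded derivatives for which there exist $\delta_-,\delta_+>0$ such that $\delta_-\le\sigma_{\mathrm b}\le\delta_+$. Finally, for any $n\ge1$ there exists $S_n\in\mathbb{R}_+$ such that $|\sigma^{(n)}(q)|\le S_n|q|^{\gamma/2-n}$ for $|q|\ge1$. The coefficient $\sigma$ satisfies $\sigma^2(q)=D(q)$ for all $q\ge M$. Initial-condition assumption: $\mathfrak{C}_0$ is a smooth bounded function on $\mathbb{R}$ and, for all $n\ge1$, there is $R_n'\in\mathbb{R}_+$ with $\|\mathfrak{C}_0^{(n)}\sigma_0^n\|_{\mathcal{C}^0}\le R_n'$ (supremum norm on $\mathbb{R}$). *)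

(* Defs.v *)
From Stdlib Require Import Reals.
From Coquelicot Require Import Coquelicot.

Open Scope R_scope.

Definition Rplus_set (x : R) : Prop := 0 <= x.

Definition segment (a b : R) (x : R) : Prop := a <= x <= b.

(** Derivative relative to [D]: only the values of [f] on [D] matter.  It is the
    usual derivative at interior points of [D] and the one-sided derivative at
    the endpoints of an interval. *)
Definition is_derive_on (D : R -> Prop) (f : R -> R) (x l : R) : Prop :=
  filterdiff f (within D (locally x)) (fun h : R => scal h l).

(** [d k] is the [k]-th derivative relative to [D]. *)
Definition smooth_on (D : R -> Prop) (f : R -> R) : Prop :=
  exists d : nat -> R -> R,
    (forall x, D x -> d 0%nat x = f x) /\
    (forall k x, D x -> is_derive_on D (d k) x (d (S k) x)).

Definition smooth (f : R -> R) : Prop := forall n x, ex_derive_n f n x.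

(** [C^oo] on the closed half-plane [t >= 0], up to the boundary: [d i j] is the
    partial derivative of order [i] in [t] (one-sided at [t = 0]) and of order
    [j] in [q]; all of them exist and are jointly continuous. *)
Definition smooth_half_plane (f : R -> R -> R) : Prop :=
  exists d : nat -> nat -> R -> R -> R,
    (forall t q, 0 <= t -> d 0%nat 0%nat t q = f t q) /\
    (forall i j,
        continuous_on (fun p : R * R => 0 <= fst p)
                      (fun p : R * R => d i j (fst p) (snd p)) /\
        (forall t q, 0 <= t ->
           is_derive_on Rplus_set (fun s => d i j s q) t (d (S i) j t q) /\
           is_derive (fun x => d i j t x) q (d i (S j) t q))).

Definition bounded_derivatives (f : R -> R) : Prop :=
  forall n, (1 <= n)%nat -> exists B, forall x, Rabs (Derive_n f n x) <= B.

(** [f x = O(x^a)] as [x -> +oo]. *)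
Definition is_O_power (f : R -> R) (a : R) : Prop :=
  exists A, Rbar_locally p_infty (fun x => Rabs (f x) <= A * Rpower x a).

Definition F (C1 : R) (alpha beta : R -> R) (x : R) : R :=
  beta x * C1 - alpha x.

Definition D (C1 : R) (alpha beta : R -> R) (x : R) : R :=
  beta x * C1 + alpha x.

(** The rates are functions on [[0, +oo)]: their values on the negative
    half-line are irrelevant.  The two-sided [Derive_n] is used only near
    [+oo], where it agrees with the derivative on the half-line. *)
Record rate (gamma : R) (a : R -> R) : Prop := {
  rate_smooth : smooth_on Rplus_set a;
  rate_nonneg : forall x, 0 <= x -> 0 <= a x;
  rate_nondecr : forall x y, 0 <= x -> x <= y -> a x <= a y;
  rate_growth : forall k, (k <= 2)%nat ->
    is_O_power (Derive_n a k) (gamma - INR k)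
}.

Record rates_assumption (C1 gamma M : R) (alpha beta : R -> R) : Prop := {
  gamma_range : 0 <= gamma <= 1 / 2;
  alpha_rate : rate gamma alpha;
  beta_rate : rate gamma beta;
  M_pos : 0 < M;
  F_pos : forall x, M <= x -> 0 < F C1 alpha beta x;
  F_incr : forall x y, M <= x -> x < y ->
    F C1 alpha beta x < F C1 alpha beta y;
  F_growth : exists Kminus Kplus, 0 < Kminus /\ 0 < Kplus /\
    forall x, M <= x ->
      Kminus * Rpower x gamma <= F C1 alpha beta x <= Kplus * Rpower x gamma
}.

(** Here "bounded derivatives" concerns the orders [n >= 1]; [sigma] itself is
    unbounded as soon as [gamma > 0]. *)
Record diffusion_assumption (C1 gamma M : R) (alpha beta : R -> R)
    (sigma sigma0 sigmab : R -> R) : Prop := {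
  sigma_smooth : smooth sigma;
  sigma_pos : forall q, 0 < sigma q;
  sigma_bounded_derivatives : bounded_derivatives sigma;
  sigma_factor : forall q, sigma q = sigma0 q * sigmab q;
  sigma0_far : forall q, 1 <= Rabs q -> sigma0 q = Rpower (Rabs q) (gamma / 2);
  sigmab_smooth : smooth sigmab;
  sigmab_bounded_derivatives : bounded_derivatives sigmab;
  sigmab_bounds : exists delta_minus delta_plus,
    0 < delta_minus /\ 0 < delta_plus /\
    forall q, delta_minus <= sigmab q <= delta_plus;
  sigma_decay : forall n, (1 <= n)%nat -> exists S_n, 0 <= S_n /\
    forall q, 1 <= Rabs q ->
      Rabs (Derive_n sigma n q) <= S_n * Rpower (Rabs q) (gamma / 2 - INR n);
  sigma_sqr : forall q, M <= q -> (sigma q) ^ 2 = D C1 alpha beta q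
}.

Record initial_assumption (sigma0 c0 : R -> R) : Prop := {
  c0_smooth : smooth c0;
  c0_bounded : exists B, forall q, Rabs (c0 q) <= B;
  c0_derivatives : forall n, (1 <= n)%nat -> exists R'_n, 0 <= R'_n /\
    forall q, Rabs (Derive_n c0 n q * (sigma0 q) ^ n) <= R'_n
}.

Record bounded_smooth_solution (sigma c0 : R -> R) (c : R -> R -> R) : Prop := {
  solution_smooth : smooth_half_plane c;
  solution_bounded : exists B, forall t q, 0 <= t -> Rabs (c t q) <= B;
  solution_pde : forall t q, 0 <= t ->
    is_derive_on Rplus_set (fun s => c s q) t
      (1 / 2 * (sigma q) ^ 2 * Derive_n (fun x => c t x) 2 q);
  solution_initial : forall q, c 0 q = c0 q
}.

Definition G (C1 M : R) (alpha beta : R -> R) (x : R) : R :=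
  RInt (fun y => / F C1 alpha beta y) M x.

(** Inverse of the bijection [G : [M, +oo) -> [0, +oo)], by definite
    description; meaningful for [s >= 0]. *)
Definition Ginv (C1 M : R) (alpha beta : R -> R) (s : R) : R :=
  iota (fun y : R => M <= y /\ G C1 M alpha beta y = s).

Definition Q (C1 M : R) (alpha beta : R -> R) (t x : R) : R :=
  Ginv C1 M alpha beta (G C1 M alpha beta x - t).

Definition Chat (C1 M : R) (alpha beta : R -> R) (c : R -> R -> R)
    (n : nat) (t : R) : R :=
  c t (Q C1 M alpha beta t (INR n)).

(* Main.v *)
Require Import Defs.
From Stdlib Require Import Reals Lra Lia ClassicalEpsilon.
From Coquelicot Require Import Coquelicot.

Open Scope R_scope.

(** Along the characteristics [dQ/dt = - F(Q)], the function [c (t, Q (t, n))]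
    has time derivative [1/2 D(Q) c_qq - F(Q) c_q], because [sigma^2 = D] there.
    The discrete right-hand side is expanded by Taylor's formula in [q] around
    [Q_n = Q (t, n)]: with [h = Q_(n+1) - Q_n] or [h = Q_(n-1) - Q_n],
    [c (t, Q_n + h) = c + c_q h + c_qq h^2 / 2 + O(c_qqq h^3)].  Put
    [s = n^(gamma/2)].  Three facts make the difference of the two sides
    [O(1/s)].

    - The derivatives of the solution decay: [c_q = O(1/s)], [c_qq = O(1/s^2)]
      and [c_qqq = O(1/s^3)], uniformly on the time interval
      ([solution_derivative_decay]).
    - A characteristic travels a distance [O(n^gamma)], over which [alpha] and
      [beta] vary by [O(n^(gamma-1) n^gamma) = O(1)] since [gamma <= 1/2]; hence
      replacing [n - 1], [n], [n + 1] by [Q_n] in the coefficients of [c_q] and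
      [c_qq] costs [O(1)], while the coefficient of [c] itself is
      [O(n^(gamma-1))], which is [O(1/s)].
    - The ratio of increments of [Q] in [n] is a ratio of values of [F], so that
      [h = 1 + O(n^(-gamma))], respectively [h = -1 + O(n^(-gamma))]
      ([Q_increment_space]).

    [large_index_remainder] collects these estimates.  For the finitely many
    remaining indices, the remainder is continuous on a compact interval, so that
    the bound [K] can be taken constant.

    The decay of the derivatives is a local statement.  Zooming at a large [q]
    with the diffusive length [q^(gamma/2)] turns the equation into a uniformly
    parabolic one on [|y| <= 1], with coefficients, solution and initial
    derivatives bounded independently of [q].  Bernstein's method
    ([bernstein_estimate]), that is, the maximum principle on a rectangle applied
    to [z^2 v^2 + lam u^2] with [v = u_y] and a cutoff [z], bounds one more
    derivative on a smaller interval; it is used three times. *)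

(** * Derivatives relative to a set *)

Lemma within_locally_R : forall (E : R -> Prop) (x : R) (P : R -> Prop),
  within E (locally x) P <->
  exists d, 0 < d /\ forall y, E y -> Rabs (y - x) < d -> P y.
Proof.
intros E x P; split.
- intros [d Hd]; exists d; split; [apply cond_pos|].
  intros y Hy Hyx; apply Hd; assumption.
- intros [d [Hd HP]]; exists (mkposreal d Hd).
  intros y Hyx Hy; apply HP; assumption.
Qed.

(** Caratheodory's form: the slope function extends to [x] with value [l].
    Sums, products and compositions of derivatives become limits of slopes. *)
Lemma is_derive_on_slope : forall (E : R -> Prop) (f : R -> R) (x l : R),
  E x ->
  (is_derive_on E f x l <->
   exists psi : R -> R, filterlim psi (within E (locally x)) (locally l) /\
     forall y, E y -> f y - f x = psi y * (y - x)).
Proof.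
intros E f x l Hx; split.
- intros [_ Hf].
  assert (Hlim : is_filter_lim (within E (locally x)) x).
  { intros P HP. apply filter_le_within. exact HP. }
  specialize (Hf x Hlim).
  exists (fun y => if Req_EM_T y x then l else (f y - f x) / (y - x)); split.
  + intros P [e He]. unfold filtermap.
    specialize (Hf (mkposreal (e / 2) (is_pos_div_2 e))).
    apply within_locally_R in Hf; destruct Hf as [d [Hd Hf]].
    apply within_locally_R; exists d; split; [exact Hd|].
    intros y Hy Hyx; apply He.
    change (Rabs ((if Req_EM_T y x then l else (f y - f x) / (y - x)) - l) < e).
    destruct (Req_EM_T y x) as [_|Hne].
    * rewrite Rminus_diag, Rabs_R0; apply cond_pos.
    * specialize (Hf y Hy Hyx).
      unfold norm, minus, plus, opp, scal in Hf; simpl in Hf.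
      unfold abs, mult in Hf; simpl in Hf.
      assert (Hp : 0 < Rabs (y - x)) by (apply Rabs_pos_lt; lra).
      replace ((f y - f x) / (y - x) - l)
        with ((f y + - f x + - ((y + - x) * l)) / (y - x)) by (field; lra).
      unfold Rdiv at 1; rewrite Rabs_mult, Rabs_inv.
      apply Rle_lt_trans with (e / 2).
      -- apply Rmult_le_reg_r with (Rabs (y - x)); [exact Hp|].
         rewrite Rmult_assoc, Rinv_l, Rmult_1_r; [exact Hf|lra].
      -- generalize (cond_pos e); lra.
  + intros y _; destruct (Req_EM_T y x) as [->|Hne]; [ring|field; lra].
- intros [psi [Hpsi Heq]]; split.
  + apply (is_linear_scal_l l).
  + intros x' Hx'.
    assert (x' = x).
    { apply NNPP; intro Hne.
      assert (Hd : 0 < Rabs (x - x')) by (apply Rabs_pos_lt; lra).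
      specialize (Hx' (fun y => Rabs (y - x') < Rabs (x - x'))).
      assert (H : locally x' (fun y => Rabs (y - x') < Rabs (x - x'))).
      { exists (mkposreal _ Hd); intros y Hy; exact Hy. }
      specialize (Hx' H); apply within_locally_R in Hx'.
      destruct Hx' as [d [Hd' Hx']].
      specialize (Hx' x Hx); rewrite Rminus_diag, Rabs_R0 in Hx'.
      specialize (Hx' Hd'); lra. }
    subst x'; intros eps.
    specialize (Hpsi (fun z => Rabs (z - l) < eps)).
    assert (H : locally l (fun z => Rabs (z - l) < eps)).
    { exists eps; intros z Hz; exact Hz. }
    specialize (Hpsi H); unfold filtermap in Hpsi.
    apply within_locally_R in Hpsi; destruct Hpsi as [d [Hd Hpsi]].
    apply within_locally_R; exists d; split; [exact Hd|].
    intros y Hy Hyx; specialize (Hpsi y Hy Hyx).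
    unfold norm, minus, plus, opp, scal; simpl; unfold abs, mult; simpl.
    replace (f y + - f x + - ((y + - x) * l)) with ((psi y - l) * (y - x))
      by (generalize (Heq y Hy); lra).
    rewrite Rabs_mult; apply Rmult_le_compat_r; [apply Rabs_pos|].
    apply Rlt_le, Hpsi.
Qed.

Lemma filterlim_within_eps : forall (E : R -> Prop) (f : R -> R) (x l : R),
  (filterlim f (within E (locally x)) (locally l) <->
   forall eps, 0 < eps -> exists d, 0 < d /\
     forall y, E y -> Rabs (y - x) < d -> Rabs (f y - l) < eps).
Proof.
intros E f x l; split.
- intros Hf eps Heps.
  specialize (Hf (fun z => Rabs (z - l) < eps)).
  assert (H : locally l (fun z => Rabs (z - l) < eps)).
  { exists (mkposreal _ Heps); intros z Hz; exact Hz. }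
  specialize (Hf H); unfold filtermap in Hf.
  apply within_locally_R in Hf; exact Hf.
- intros Hf P [e He]; unfold filtermap; apply within_locally_R.
  destruct (Hf e (cond_pos e)) as [d [Hd Hf']].
  exists d; split; [exact Hd|]; intros y Hy Hyx; apply He, Hf'; assumption.
Qed.

Lemma is_derive_on_continuous : forall (E : R -> Prop) (f : R -> R) (x l : R),
  E x -> is_derive_on E f x l ->
  filterlim f (within E (locally x)) (locally (f x)).
Proof.
intros E f x l Hx Hf; apply is_derive_on_slope in Hf; [|exact Hx].
destruct Hf as [psi [Hpsi Heq]].
apply filterlim_within_eps; intros eps Heps.
rewrite filterlim_within_eps in Hpsi.
destruct (Hpsi 1 Rlt_0_1) as [d [Hd H]].
assert (Hl : 0 < Rabs l + 1) by (generalize (Rabs_pos l); lra).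
exists (Rmin d (eps / (Rabs l + 1))); split.
- apply Rmin_pos; [exact Hd|]; apply Rdiv_lt_0_compat; assumption.
- intros y Hy Hyx; rewrite (Heq y Hy), Rabs_mult.
  assert (H1 : Rabs (psi y) < Rabs l + 1).
  { specialize (H y Hy (Rlt_le_trans _ _ _ Hyx (Rmin_l _ _))).
    generalize (Rabs_triang_inv (psi y) l); lra. }
  apply Rle_lt_trans with ((Rabs l + 1) * Rabs (y - x)).
  + apply Rmult_le_compat_r; [apply Rabs_pos|lra].
  + apply Rmult_lt_reg_r with (/ (Rabs l + 1)); [apply Rinv_0_lt_compat, Hl|].
    replace ((Rabs l + 1) * Rabs (y - x) * / (Rabs l + 1)) with (Rabs (y - x))
      by (field; lra).
    apply Rlt_le_trans with (1 := Hyx), Rmin_r.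
Qed.

Lemma is_derive_on_ext : forall (E : R -> Prop) (f g : R -> R) (x l : R),
  E x -> (forall y, E y -> f y = g y) ->
  is_derive_on E f x l -> is_derive_on E g x l.
Proof.
intros E f g x l Hx Hfg Hf; apply is_derive_on_slope in Hf; [|exact Hx].
destruct Hf as [psi [Hpsi Heq]].
apply is_derive_on_slope; [exact Hx|]; exists psi; split; [exact Hpsi|].
intros y Hy; rewrite <- !Hfg by assumption; auto.
Qed.

Lemma is_derive_on_subset : forall (E E' : R -> Prop) (f : R -> R) (x l : R),
  E' x -> (forall y, E' y -> E y) ->
  is_derive_on E f x l -> is_derive_on E' f x l.
Proof.
intros E E' f x l Hx HE Hf; apply is_derive_on_slope in Hf; [|auto].
destruct Hf as [psi [Hpsi Heq]].
apply is_derive_on_slope; [exact Hx|]; exists psi; split; [|auto].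
rewrite filterlim_within_eps in Hpsi; apply filterlim_within_eps.
intros eps Heps; destruct (Hpsi eps Heps) as [d [Hd H]].
exists d; split; auto.
Qed.

Lemma is_derive_on_interior : forall (E : R -> Prop) (f : R -> R) (x l : R),
  locally x E -> is_derive_on E f x l -> is_derive f x l.
Proof.
intros E f x l HE [Hl Hf]; split; [exact Hl|].
intros x' Hx' eps.
assert (Hw : is_filter_lim (within E (locally x)) x').
{ intros P HP; apply filter_le_within, Hx', HP. }
specialize (Hf x' Hw eps).
generalize (filter_and _ _ HE Hf); apply filter_imp.
intros y [H1 H2]; apply H2, H1.
Qed.

Lemma is_derive_on_of_is_derive : forall (E : R -> Prop) (f : R -> R) (x l : R),
  E x -> is_derive f x l -> is_derive_on E f x l.
Proof.
intros E f x l Hx [Hl Hf]; split; [exact Hl|].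
intros x' Hx' eps.
assert (H : is_derive_on (fun _ => True) f x l -> is_derive_on E f x l).
{ intros H; apply is_derive_on_subset with (2 := fun _ _ => I); auto. }
refine (proj2 (H _) x' Hx' eps).
split; [exact Hl|]; intros z Hz e.
apply filter_le_within, Hf.
intros P HP.
generalize (Hz P HP); unfold within; apply filter_imp; auto.
Qed.

Lemma is_derive_on_unique : forall (f : R -> R) (x l l' : R),
  0 <= x -> is_derive_on Rplus_set f x l -> is_derive_on Rplus_set f x l' ->
  l = l'.
Proof.
intros f x l l' Hx H H'.
apply is_derive_on_slope in H; [|exact Hx].
apply is_derive_on_slope in H'; [|exact Hx].
destruct H as [psi [Hp Heq]]; destruct H' as [psi' [Hp' Heq']].
rewrite filterlim_within_eps in Hp; rewrite filterlim_within_eps in Hp'.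
apply NNPP; intro Hne.
assert (He : 0 < Rabs (l - l') / 2).
{ generalize (Rabs_pos_lt (l - l')); lra. }
destruct (Hp _ He) as [d [Hd H]]; destruct (Hp' _ He) as [d' [Hd' H']].
assert (Hm := Rmin_pos _ _ Hd Hd').
assert (Hm1 := Rmin_l d d'); assert (Hm2 := Rmin_r d d').
set (m := Rmin d d') in *.
assert (Hy : 0 <= x + m / 2) by lra.
assert (Ha : Rabs (x + m / 2 - x) < m).
{ rewrite Rabs_pos_eq; lra. }
specialize (H _ Hy (Rlt_le_trans _ _ _ Ha Hm1)).
specialize (H' _ Hy (Rlt_le_trans _ _ _ Ha Hm2)).
assert (E : psi (x + m / 2) = psi' (x + m / 2)).
{ apply Rmult_eq_reg_r with (x + m / 2 - x); [|lra].
  rewrite <- Heq, <- Heq'; auto. }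
rewrite E in H.
generalize (Rabs_triang (l - psi' (x + m / 2)) (psi' (x + m / 2) - l')).
rewrite (Rabs_minus_sym l).
replace (l - psi' (x + m / 2) + (psi' (x + m / 2) - l')) with (l - l') by ring.
lra.
Qed.

Lemma filterlim_within_plus : forall (E : R -> Prop) (f g : R -> R) x a b,
  filterlim f (within E (locally x)) (locally a) ->
  filterlim g (within E (locally x)) (locally b) ->
  filterlim (fun y => f y + g y) (within E (locally x)) (locally (a + b)).
Proof.
intros E f g x a b Hf Hg.
apply filterlim_comp_2 with (1 := Hf) (2 := Hg) (h := Rplus).
apply (filterlim_plus a b).
Qed.

Lemma filterlim_within_mult : forall (E : R -> Prop) (f g : R -> R) x a b,
  filterlim f (within E (locally x)) (locally a) ->
  filterlim g (within E (locally x)) (locally b) ->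
  filterlim (fun y => f y * g y) (within E (locally x)) (locally (a * b)).
Proof.
intros E f g x a b Hf Hg.
apply filterlim_comp_2 with (1 := Hf) (2 := Hg) (h := Rmult).
apply (filterlim_mult a b).
Qed.

Lemma is_derive_on_plus : forall (E : R -> Prop) (f g : R -> R) x lf lg,
  E x -> is_derive_on E f x lf -> is_derive_on E g x lg ->
  is_derive_on E (fun y => f y + g y) x (lf + lg).
Proof.
intros E f g x lf lg Hx Hf Hg.
apply is_derive_on_slope in Hf; [|exact Hx].
apply is_derive_on_slope in Hg; [|exact Hx].
destruct Hf as [p [Hp Ep]]; destruct Hg as [q [Hq Eq]].
apply is_derive_on_slope; [exact Hx|]; exists (fun y => p y + q y); split.
- apply filterlim_within_plus; assumption.
- intros y Hy; generalize (Ep y Hy) (Eq y Hy); lra.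
Qed.

Lemma is_derive_on_mult : forall (E : R -> Prop) (f g : R -> R) x lf lg,
  E x -> is_derive_on E f x lf -> is_derive_on E g x lg ->
  is_derive_on E (fun y => f y * g y) x (lf * g x + f x * lg).
Proof.
intros E f g x lf lg Hx Hf Hg.
assert (Cg := is_derive_on_continuous _ _ _ _ Hx Hg).
apply is_derive_on_slope in Hf; [|exact Hx].
apply is_derive_on_slope in Hg; [|exact Hx].
destruct Hf as [p [Hp Ep]]; destruct Hg as [q [Hq Eq]].
apply is_derive_on_slope; [exact Hx|].
exists (fun y => p y * g y + f x * q y); split.
- apply filterlim_within_plus; apply filterlim_within_mult; try assumption.
  apply filterlim_const.
- intros y Hy.
  replace (f y * g y - f x * g x)
    with ((f y - f x) * g y + f x * (g y - g x)) by ring.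
  rewrite (Ep y Hy), (Eq y Hy); ring.
Qed.

Lemma is_derive_on_comp : forall (E E' : R -> Prop) (f g : R -> R) x lf lg,
  E x -> (forall y, E y -> E' (g y)) ->
  is_derive_on E' f (g x) lf -> is_derive_on E g x lg ->
  is_derive_on E (fun y => f (g y)) x (lf * lg).
Proof.
intros E E' f g x lf lg Hx HE Hf Hg.
assert (Cg := is_derive_on_continuous _ _ _ _ Hx Hg).
apply is_derive_on_slope in Hf; [|auto].
apply is_derive_on_slope in Hg; [|exact Hx].
destruct Hf as [p [Hp Ep]]; destruct Hg as [q [Hq Eq]].
apply is_derive_on_slope; [exact Hx|].
exists (fun y => p (g y) * q y); split.
- apply filterlim_within_mult; [|exact Hq].
  rewrite filterlim_within_eps in Hp; rewrite filterlim_within_eps in Cg.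
  apply filterlim_within_eps; intros eps Heps.
  destruct (Hp eps Heps) as [d [Hd H]]; destruct (Cg d Hd) as [d' [Hd' H']].
  exists d'; split; auto.
- intros y Hy; rewrite (Ep (g y) (HE y Hy)), (Eq y Hy); ring.
Qed.

Lemma is_derive_on_half_line_pos : forall (f : R -> R) (t l : R),
  0 < t -> is_derive_on Rplus_set f t l -> is_derive f t l.
Proof.
intros f t l Ht; apply is_derive_on_interior.
exists (mkposreal t Ht); intros y Hy.
change (Rabs (y - t) < t) in Hy; apply Rabs_def2 in Hy.
unfold Rplus_set; lra.
Qed.

(** A function continuous relative to the half-line becomes continuous on the
    whole line when frozen at its value at [0]. *)
Lemma continuous_Rmax_extension : forall (f : R -> R) (t : R),
  (forall s, 0 <= s -> filterlim f (within Rplus_set (locally s)) (locally (f s))) ->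
  continuity_pt (fun s => f (Rmax s 0)) t.
Proof.
intros f t Hf; apply continuity_pt_filterlim.
apply filterlim_comp with (2 := Hf (Rmax t 0) (Rmax_r t 0)).
intros P [d Hd]; exists d; intros y Hy.
apply Hd; [|apply Rmax_r].
change (Rabs (Rmax y 0 - Rmax t 0) < d).
change (Rabs (y - t) < d) in Hy.
apply Rle_lt_trans with (2 := Hy).
unfold Rmax; destruct (Rle_dec y 0) as [h|h], (Rle_dec t 0) as [h'|h'];
try apply Rnot_le_lt in h; try apply Rnot_le_lt in h';
unfold Rabs; repeat destruct Rcase_abs; lra.
Qed.

Lemma MVT_half_line : forall (f f' : R -> R) (a b : R),
  (forall t, 0 <= t -> is_derive_on Rplus_set f t (f' t)) ->
  0 <= a -> 0 <= b ->
  exists xi, Rmin a b <= xi <= Rmax a b /\ f b - f a = f' xi * (b - a).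
Proof.
intros f f' a b Hf Ha Hb.
assert (Hm : 0 <= Rmin a b) by (apply Rmin_glb; assumption).
destruct (MVT_gen (fun s => f (Rmax s 0)) a b f') as [xi [Hxi Heq]].
- intros x Hx.
  assert (Hx0 : 0 < x) by lra.
  apply is_derive_ext_loc with f.
  + exists (mkposreal x Hx0); intros y Hy.
    change (Rabs (y - x) < x) in Hy; apply Rabs_def2 in Hy.
    rewrite Rmax_left; [reflexivity|lra].
  + apply is_derive_on_half_line_pos, Hf; lra.
- intros x _; apply continuous_Rmax_extension.
  intros s Hs; apply is_derive_on_continuous with (f' s); auto.
- exists xi; split; [exact Hxi|].
  rewrite !Rmax_left in Heq by assumption; exact Heq.
Qed.

Lemma continuous_on_half_plane_eps : forall (f : R -> R -> R) (t q : R),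
  continuous_on (fun p : R * R => 0 <= fst p)
    (fun p : R * R => f (fst p) (snd p)) ->
  0 <= t -> forall eps, 0 < eps -> exists d, 0 < d /\
    forall s x, 0 <= s -> Rabs (s - t) < d -> Rabs (x - q) < d ->
      Rabs (f s x - f t q) < eps.
Proof.
intros f t q Hf Ht eps Heps.
specialize (Hf (t, q) Ht (fun z => Rabs (z - f t q) < eps)).
assert (H : locally (f t q) (fun z => Rabs (z - f t q) < eps)).
{ exists (mkposreal _ Heps); intros z Hz; exact Hz. }
destruct (Hf H) as [d Hd]; exists d; split; [apply cond_pos|].
intros s x Hs Hst Hxq; apply (Hd (s, x)); [split; assumption|exact Hs].
Qed.

(** Chain rule along a curve [s |-> (s, g s)] in the closed half-plane; joint
    continuity is only needed for the derivative in [t]. *)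
Lemma is_derive_on_curve : forall (E : R -> Prop) (f ft : R -> R -> R)
    (fq g : R -> R) (x lg : R),
  (forall s, E s -> 0 <= s) -> E x ->
  (forall t q, 0 <= t -> is_derive_on Rplus_set (fun s => f s q) t (ft t q)) ->
  continuous_on (fun p : R * R => 0 <= fst p)
    (fun p : R * R => ft (fst p) (snd p)) ->
  is_derive (f x) (g x) (fq (g x)) ->
  is_derive_on E g x lg ->
  is_derive_on E (fun s => f s (g s)) x (ft x (g x) + fq (g x) * lg).
Proof.
intros E f ft fq g x lg HE Hx Hft Cft Hfq Hg.
assert (Hx0 := HE x Hx).
assert (Cg := is_derive_on_continuous _ _ _ _ Hx Hg).
assert (H2 : is_derive_on E (fun s => f x (g s)) x (fq (g x) * lg)).
{ apply (is_derive_on_comp E (fun _ => True)); auto.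
  apply is_derive_on_of_is_derive; auto. }
apply is_derive_on_slope in H2; [|exact Hx].
destruct H2 as [p [Hp Ep]].
apply is_derive_on_slope; [exact Hx|].
exists (fun s => (if Req_EM_T s x then ft x (g x)
                  else (f s (g s) - f x (g s)) / (s - x)) + p s); split.
- apply filterlim_within_plus; [|exact Hp].
  rewrite filterlim_within_eps in Cg; apply filterlim_within_eps.
  intros eps Heps.
  destruct (continuous_on_half_plane_eps ft x (g x) Cft Hx0 eps Heps)
    as [d [Hd H]].
  destruct (Cg d Hd) as [d' [Hd' H']].
  exists (Rmin d d'); split; [apply Rmin_pos; assumption|].
  intros s Hs Hsx.
  assert (Hs1 := Rlt_le_trans _ _ _ Hsx (Rmin_l d d')).
  assert (Hs2 := Rlt_le_trans _ _ _ Hsx (Rmin_r d d')).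
  destruct (Req_EM_T s x) as [_|Hne].
  + rewrite Rminus_diag, Rabs_R0; exact Heps.
  + destruct (MVT_half_line (fun s' => f s' (g s)) (fun s' => ft s' (g s)) x s)
      as [xi [Hxi Heq]]; auto.
    rewrite Heq; unfold Rdiv; rewrite Rmult_assoc, Rinv_r, Rmult_1_r by lra.
    assert (Hm : 0 <= Rmin x s) by (apply Rmin_glb; auto).
    apply H; auto; [lra|].
    apply Rle_lt_trans with (2 := Hs1).
    revert Hxi; unfold Rmin, Rmax; destruct (Rle_dec x s) as [h|h]; intros;
    try apply Rnot_le_lt in h;
        unfold Rabs; repeat destruct Rcase_abs; lra.
- intros s Hs.
  replace (f s (g s) - f x (g x))
    with (f s (g s) - f x (g s) + (f x (g s) - f x (g x))) by ring.
  rewrite (Ep s Hs).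
  destruct (Req_EM_T s x) as [->|Hne]; [ring|field; lra].
Qed.

(** * Maximum principle on a rectangle *)

(** Extreme value theorem on [[0, T] x [-r, r]]: maximize in [y] for fixed [t];
    the resulting function of [t] is continuous by uniform continuity. *)
Lemma max_on_rectangle : forall (f : R -> R -> R) (T r : R),
  0 <= T -> 0 <= r ->
  continuous_on (fun p : R * R => 0 <= fst p)
    (fun p : R * R => f (fst p) (snd p)) ->
  exists t0 y0, 0 <= t0 <= T /\ - r <= y0 <= r /\
    forall t y, 0 <= t <= T -> - r <= y <= r -> f t y <= f t0 y0.
Proof.
intros f T r HT Hr Cf.
pose (g t y := f (Rmax t 0) y).
assert (Hg : forall t y, continuity_2d_pt g t y).
{ intros t y eps.
  destruct (continuous_on_half_plane_eps f (Rmax t 0) y Cf (Rmax_r t 0)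
              eps (cond_pos eps)) as [d [Hd H]].
  exists (mkposreal d Hd); intros u v Hu Hv; apply H; auto.
  - apply Rmax_r.
  - apply Rle_lt_trans with (2 := Hu).
    unfold Rmax; destruct (Rle_dec u 0) as [h|h], (Rle_dec t 0) as [h'|h'];
    try apply Rnot_le_lt in h; try apply Rnot_le_lt in h';
    unfold Rabs; repeat destruct Rcase_abs; lra. }
assert (Hy : forall t, exists y, - r <= y <= r /\
          forall y', - r <= y' <= r -> g t y' <= g t y).
{ intros t; destruct (continuity_ab_maj (g t) (- r) r) as [y [H1 H2]].
  - lra.
  - intros y _; apply continuity_pt_filterlim; intros P [e He].
    destruct (Hg t y e) as [d Hd].
    exists d; intros z Hz; apply He, Hd; [|exact Hz].
    rewrite Rminus_diag, Rabs_R0; apply cond_pos.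
  - exists y; auto. }
pose (Y t := proj1_sig (constructive_indefinite_description _ (Hy t))).
assert (HY : forall t, - r <= Y t <= r /\
          forall y', - r <= y' <= r -> g t y' <= g t (Y t)).
{ intros t; exact (proj2_sig (constructive_indefinite_description _ (Hy t))). }
destruct (continuity_ab_maj (fun t => g (Rmax (Rmin t T) 0)
                               (Y (Rmax (Rmin t T) 0))) 0 T HT) as [t0 [H1 H2]].
- intros t Ht; apply continuity_pt_filterlim; intros P [e He].
  destruct (uniform_continuity_2d g 0 T (- r) r (fun x y _ _ => Hg x y) e)
    as [d Hd].
  exists d; intros s Hs; apply He.
  change (Rabs (s - t) < d) in Hs.
  set (s' := Rmax (Rmin s T) 0).
  assert (Ht' : Rmax (Rmin t T) 0 = t).
  { rewrite Rmin_left, Rmax_left; lra. }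
  rewrite Ht'.
  assert (Hs' : 0 <= s' <= T).
  { unfold s'; split; [apply Rmax_r|].
    apply Rmax_lub; [apply Rmin_r|exact HT]. }
  assert (Hst : Rabs (s' - t) < d).
  { apply Rle_lt_trans with (2 := Hs); unfold s', Rmax, Rmin.
    destruct (Rle_dec s T) as [h|h]; try apply Rnot_le_lt in h;
    match goal with |- context [Rle_dec ?a 0] => destruct (Rle_dec a 0) as [h'|h'];
      try apply Rnot_le_lt in h' end;
    unfold Rabs; repeat destruct Rcase_abs; lra. }
  change (Rabs (g s' (Y s') - g t (Y t)) < e).
  destruct (HY t) as [Yt1 Yt2]; destruct (HY s') as [Ys1 Ys2].
  assert (Hz : Rabs 0 < d) by (rewrite Rabs_R0; apply cond_pos).
  assert (A1 : Rabs (g s' (Y t) - g t (Y t)) < e).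
  { apply Hd; auto; rewrite Rminus_diag; auto. }
  assert (A2 : Rabs (g s' (Y s') - g t (Y s')) < e).
  { apply Hd; auto; rewrite Rminus_diag; auto. }
  specialize (Yt2 _ Ys1); specialize (Ys2 _ Yt1).
  apply Rabs_def2 in A1; apply Rabs_def2 in A2; apply Rabs_def1; lra.
- assert (Hcl : forall t, 0 <= t <= T -> Rmax (Rmin t T) 0 = t).
  { intros t Ht; rewrite Rmin_left, Rmax_left; lra. }
  exists t0, (Y t0); split; [exact H2|]; split; [apply HY|].
  intros t y Ht Hy'; specialize (H1 t Ht); rewrite !Hcl in H1 by assumption.
  replace (f t y) with (g t y) by (unfold g; rewrite Rmax_left; [reflexivity|lra]).
  replace (f t0 (Y t0)) with (g t0 (Y t0))
    by (unfold g; rewrite Rmax_left; [reflexivity|lra]).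
  apply Rle_trans with (2 := H1), HY, Hy'.
Qed.

Lemma is_derive_pos_right : forall (f : R -> R) (x l : R),
  is_derive f x l -> 0 < l ->
  exists d, 0 < d /\ forall y, x < y < x + d -> f x < f y.
Proof.
intros f x l Hf Hl; apply is_derive_Reals in Hf.
destruct (Hf (l / 2)) as [d Hd]; [lra|].
exists d; split; [apply cond_pos|]; intros y Hy.
assert (Hh : Rabs (y - x) < d) by (rewrite Rabs_pos_eq; lra).
specialize (Hd (y - x) ltac:(lra) Hh).
replace (x + (y - x)) with y in Hd by ring.
apply Rabs_def2 in Hd.
assert (H : l / 2 < (f y - f x) / (y - x)) by lra.
apply Rmult_lt_compat_r with (r := y - x) in H; [|lra].
replace ((f y - f x) / (y - x) * (y - x)) with (f y - f x) in H by (field; lra).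
assert (0 < l / 2 * (y - x)) by (apply Rmult_lt_0_compat; lra).
lra.
Qed.

Lemma is_derive_left_max : forall (f : R -> R) (x l d : R),
  is_derive f x l -> 0 < d -> (forall y, x - d < y < x -> f y <= f x) -> 0 <= l.
Proof.
intros f x l d Hf Hd H; apply Rnot_lt_le; intro Hl.
assert (Hg : is_derive (fun y => f (- y)) (- x) (- l)).
{ replace (- l) with (scal (-1) l) by (unfold scal; simpl; unfold mult; simpl; ring).
  apply is_derive_comp with (f := f) (g := fun y => - y).
  - rewrite Ropp_involutive; exact Hf.
  - auto_derive; auto; ring. }
destruct (is_derive_pos_right _ _ _ Hg ltac:(lra)) as [e [He H']].
assert (Hm := Rmin_pos _ _ Hd He).
assert (Hm1 := Rmin_l d e); assert (Hm2 := Rmin_r d e).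
specialize (H' (- x + Rmin d e / 2) ltac:(lra)).
rewrite Ropp_involutive in H'.
specialize (H (- (- x + Rmin d e / 2)) ltac:(lra)); lra.
Qed.

Lemma second_derivative_at_max : forall (f f1 : R -> R) (l a b x : R),
  a < x < b ->
  (forall y, a < y < b -> is_derive f y (f1 y)) ->
  is_derive f1 x l ->
  (forall y, a < y < b -> f y <= f x) -> l <= 0.
Proof.
intros f f1 l a b x Hx Hf Hf1 Hmax; apply Rnot_lt_le; intro Hl.
assert (H0 : 0 <= f1 x).
{ apply is_derive_left_max with f x (x - a); [apply Hf; lra|lra|].
  intros; apply Hmax; lra. }
destruct (is_derive_pos_right _ _ _ Hf1 Hl) as [d [Hd H]].
assert (Hb : 0 < b - x) by lra.
assert (Hm := Rmin_pos _ _ Hd Hb).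
assert (Hm1 := Rmin_l d (b - x)); assert (Hm2 := Rmin_r d (b - x)).
set (m := Rmin d (b - x)) in *.
assert (Hmvt : forall u v, x <= u -> u < v -> v <= x + m / 2 ->
  exists xi, u <= xi <= v /\ f v - f u = f1 xi * (v - u)).
{ intros u v Hu Huv Hv; destruct (MVT_gen f u v f1) as [xi Hxi].
  - rewrite Rmin_left, Rmax_right by lra; intros y Hy; apply Hf; lra.
  - rewrite Rmin_left, Rmax_right by lra; intros y Hy.
    apply derivable_continuous_pt; exists (f1 y).
    apply is_derive_Reals, Hf; lra.
  - rewrite Rmin_left, Rmax_right in Hxi by lra; exists xi; exact Hxi. }
(* the mean value point of the first half may be [x] itself *)
destruct (Hmvt x (x + m / 4)) as [xi [Hxi Heq]]; try lra.
destruct (Hmvt (x + m / 4) (x + m / 2)) as [xj [Hxj Heqj]]; try lra.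
assert (Hi : 0 <= f1 xi).
{ destruct (Rle_lt_or_eq_dec x xi (proj1 Hxi)) as [Hlt|<-]; [|exact H0].
  apply Rle_trans with (1 := H0), Rlt_le, H; lra. }
assert (Hj : f1 x < f1 xj) by (apply H; lra).
assert (0 <= f1 xi * (x + m / 4 - x)) by (apply Rmult_le_pos; lra).
assert (0 < f1 xj * (x + m / 2 - (x + m / 4))) by (apply Rmult_lt_0_compat; lra).
assert (f (x + m / 2) <= f x) by (apply Hmax; lra).
lra.
Qed.

(** Weak maximum principle for subsolutions with a bounded source: subtracting
    [(S + e) t] makes the inequality strict, which excludes an interior maximum. *)
Lemma parabolic_maximum_principle :
  forall (f ft fy fyy A : R -> R -> R) (T r B S : R),
  0 <= T -> 0 <= r -> 0 <= S ->
  continuous_on (fun p : R * R => 0 <= fst p)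
    (fun p : R * R => f (fst p) (snd p)) ->
  (forall t y, 0 < t <= T -> - r < y < r ->
     is_derive (fun s => f s y) t (ft t y) /\
     is_derive (f t) y (fy t y) /\ is_derive (fy t) y (fyy t y) /\
     0 <= A t y /\ ft t y - A t y * fyy t y <= S) ->
  (forall y, - r <= y <= r -> f 0 y <= B) ->
  (forall t, 0 <= t <= T -> f t (- r) <= B /\ f t r <= B) ->
  forall t y, 0 <= t <= T -> - r <= y <= r -> f t y <= B + S * T.
Proof.
intros f ft fy fyy A T r B S HT Hr HS Cf Hd H0 Hb.
assert (Heps : forall e, 0 < e -> forall t y, 0 <= t <= T -> - r <= y <= r ->
          f t y <= B + (S + e) * T).
{ intros e He.
  pose (g t y := f t y - (S + e) * t).
  destruct (max_on_rectangle g T r HT Hr) as [t0 [y0 [Ht0 [Hy0 Hmax]]]].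
  { intros [t q] Ht; unfold g; simpl.
    intros P [eps HP]; unfold filtermap, within.
    assert (Hp : 0 < eps / 2) by apply is_pos_div_2.
    destruct (continuous_on_half_plane_eps f t q Cf Ht _ Hp) as [d [Hdp H]].
    assert (Hk : 0 < eps / 2 / (S + e)) by (apply Rdiv_lt_0_compat; lra).
    exists (mkposreal _ (Rmin_pos _ _ Hdp Hk)); intros [s x] [Hs Hx] Hs0.
    simpl in *; apply HP.
    change (Rabs (s - t) < Rmin d (eps / 2 / (S + e))) in Hs.
    change (Rabs (x - q) < Rmin d (eps / 2 / (S + e))) in Hx.
    change (Rabs (f s x - (S + e) * s - (f t q - (S + e) * t)) < eps).
    assert (H1 : Rabs (f s x - f t q) < eps / 2).
    { apply H; auto; eapply Rlt_le_trans; eauto; apply Rmin_l. }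
    assert (H2 : Rabs (s - t) < eps / 2 / (S + e)).
    { eapply Rlt_le_trans; eauto; apply Rmin_r. }
    apply Rmult_lt_compat_l with (r := S + e) in H2; [|lra].
    replace ((S + e) * (eps / 2 / (S + e))) with (eps / 2) in H2 by (field; lra).
    rewrite <- (Rabs_pos_eq (S + e)) in H2 at 1 by lra.
    rewrite <- Rabs_mult in H2.
    apply Rabs_def2 in H1; apply Rabs_def2 in H2; apply Rabs_def1; lra. }
  assert (Hg0 : g t0 y0 <= B).
  { assert (Hpt : 0 <= (S + e) * t0) by (apply Rmult_le_pos; lra).
    unfold g.
    destruct (Rle_lt_or_eq_dec 0 t0 (proj1 Ht0)) as [Hp|Hz];
      [|subst t0; specialize (H0 y0 Hy0); lra].
    destruct (Rle_lt_or_eq_dec (- r) y0 (proj1 Hy0)) as [Hp1|Hz];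
      [|subst y0; generalize (proj1 (Hb t0 Ht0)); lra].
    destruct (Rle_lt_or_eq_dec y0 r (proj2 Hy0)) as [Hp2|Hz];
      [|subst y0; generalize (proj2 (Hb t0 Ht0)); lra].
    exfalso.
    destruct (Hd t0 y0 ltac:(lra) ltac:(lra)) as [D1 [D2 [D3 [HA Hle]]]].
    assert (K1 : fyy t0 y0 <= 0).
    { apply second_derivative_at_max with (f t0) (fy t0) (- r) r y0; auto.
      - intros y Hy; apply (Hd t0 y); lra.
      - intros y Hy; specialize (Hmax t0 y Ht0 ltac:(lra)); unfold g in Hmax; lra. }
    assert (K2 : 0 <= ft t0 y0 - (S + e)).
    { apply is_derive_left_max with (fun s => g s y0) t0 t0; [|exact Hp|].
      - unfold g.
        apply (is_derive_minus (fun s => f s y0) (fun s => (S + e) * s)); auto.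
        auto_derive; auto; ring.
      - intros s Hs; apply Hmax; lra. }
    assert (K3 : 0 <= A t0 y0 * - fyy t0 y0) by (apply Rmult_le_pos; lra).
    lra. }
  intros t y Ht Hy; specialize (Hmax t y Ht Hy); unfold g in Hmax at 1.
  assert ((S + e) * t <= (S + e) * T) by (apply Rmult_le_compat_l; lra).
  lra. }
intros t y Ht Hy; apply le_epsilon; intros e He.
assert (He' : 0 < e / (T + 1)) by (apply Rdiv_lt_0_compat; lra).
specialize (Heps _ He' t y Ht Hy).
assert (e / (T + 1) * T <= e).
{ apply Rle_trans with (e / (T + 1) * (T + 1)).
  - apply Rmult_le_compat_l; lra.
  - right; field; lra. }
lra.
Qed.

(** * Interior derivative estimates *)

Lemma continuous_on_mult_R : forall (E : R * R -> Prop) (f g : R * R -> R),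
  continuous_on E f -> continuous_on E g ->
  continuous_on E (fun p => f p * g p).
Proof.
intros E f g Hf Hg p Hp.
apply filterlim_comp_2 with (1 := Hf p Hp) (2 := Hg p Hp) (h := Rmult).
apply (filterlim_mult (f p) (g p)).
Qed.

Lemma continuous_on_plus_R : forall (E : R * R -> Prop) (f g : R * R -> R),
  continuous_on E f -> continuous_on E g ->
  continuous_on E (fun p => f p + g p).
Proof.
intros E f g Hf Hg p Hp.
apply filterlim_comp_2 with (1 := Hf p Hp) (2 := Hg p Hp) (h := Rplus).
apply (filterlim_plus (f p) (g p)).
Qed.

Lemma Young_weighted : forall a e p x y : R,
  0 < a -> p ^ 2 <= e * a -> 2 * (p * x * y) <= a * y ^ 2 + e * x ^ 2.
Proof.
intros a e p x y Ha Hp.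
apply Rmult_le_reg_l with a; [exact Ha|].
assert (0 <= (a * y - p * x) ^ 2) by apply pow2_ge_0.
assert (0 <= (e * a - p ^ 2) * x ^ 2)
  by (apply Rmult_le_pos; [lra|apply pow2_ge_0]).
nra.
Qed.

(** The differential inequality behind [bernstein_estimate]: [z, z1, z2] are
    the cutoff and its derivatives, [w = 1 / r^2], and [lam] is chosen so that
    the good term [- 2 lam A v^2] absorbs all terms in [v^2]. *)
Lemma bernstein_inequality :
  forall delta C w lam B A b1 b0 p2 p1 p0 u v v1 v2 z z1 z2 : R,
  0 < delta -> 0 <= C -> 0 <= w -> 0 <= lam ->
  lam * delta = C ^ 2 / delta + 68 * C * w + 3 * C ->
  delta <= A <= C ->
  Rabs b1 <= C -> Rabs b0 <= C -> Rabs p2 <= C -> Rabs p1 <= C -> Rabs p0 <= C ->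
  Rabs u <= B ->
  0 <= z <= 1 -> z1 ^ 2 <= 4 * w -> 0 <= - z2 <= 2 * w ->
  2 * z ^ 2 * v * (A * v2 + p2 * v1 + p1 * v + p0 * u)
  + 2 * lam * u * (A * v1 + b1 * v + b0 * u)
  - A * (2 * (z1 ^ 2 + z * z2) * v ^ 2 + 8 * z * z1 * v * v1
         + 2 * z ^ 2 * (v1 ^ 2 + v * v2) + 2 * lam * (v ^ 2 + u * v1))
  <= B ^ 2 * (C + lam * (C ^ 2 / delta + 2 * C)).
Proof.
intros delta C w lam B A b1 b0 p2 p1 p0 u v v1 v2 z z1 z2
  Hd HC Hw Hlam Elam HA Hb1 Hb0 Hp2 Hp1 Hp0 Hu Hz Hz1 Hz2.
assert (Hsq : forall x M, Rabs x <= M -> x ^ 2 <= M ^ 2).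
{ intros x M Hx; rewrite <- (pow2_abs x); apply pow_incr; split;
    [apply Rabs_pos|exact Hx]. }
set (e := C ^ 2 / delta) in *.
assert (He0 : 0 <= e).
{ apply Rdiv_le_0_compat; [apply pow2_ge_0|exact Hd]. }
assert (He : e * delta = C ^ 2) by (unfold e; field; lra).
assert (Hu2 := Hsq _ _ Hu).
assert (Hv2 := pow2_ge_0 v); assert (Hv12 := pow2_ge_0 v1).
assert (Hu20 := pow2_ge_0 u).
assert (Hz2' := pow2_ge_0 z).
assert (Hzz : z ^ 2 <= 1) by nra.
(* the terms containing [v1] are absorbed by [- 2 A z^2 v1^2] *)
assert (T1 : 2 * (p2 * v * v1) <= A * v1 ^ 2 + e * v ^ 2).
{ apply Young_weighted; [lra|]; apply Rle_trans with (1 := Hsq _ _ Hp2).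
  rewrite <- He; apply Rmult_le_compat_l; lra. }
assert (T1' : z ^ 2 * (2 * (p2 * v * v1)) <= z ^ 2 * (A * v1 ^ 2) + e * v ^ 2).
{ apply Rle_trans with (z ^ 2 * (A * v1 ^ 2 + e * v ^ 2)).
  - apply Rmult_le_compat_l; assumption.
  - assert (z ^ 2 * (e * v ^ 2) <= 1 * (e * v ^ 2)).
    { apply Rmult_le_compat_r; [apply Rmult_le_pos; lra|exact Hzz]. }
    lra. }
assert (T2 : - (8 * A * z * z1 * v * v1)
             <= A * (z ^ 2 * v1 ^ 2) + 64 * C * w * v ^ 2).
{ assert (0 <= A * (z * v1 + 4 * z1 * v) ^ 2)
    by (apply Rmult_le_pos; [lra|apply pow2_ge_0]).
  assert (A * z1 ^ 2 <= C * (4 * w)).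
  { apply Rmult_le_compat; try lra; apply pow2_ge_0. }
  assert (16 * (A * z1 ^ 2) * v ^ 2 <= 16 * (C * (4 * w)) * v ^ 2)
    by (apply Rmult_le_compat_r; lra).
  lra. }
assert (T3 : - (A * (2 * (z1 ^ 2 + z * z2) * v ^ 2)) <= 4 * C * w * v ^ 2).
{ assert (0 <= A * z1 ^ 2) by (apply Rmult_le_pos; [lra|apply pow2_ge_0]).
  assert (z * - z2 <= 1 * (2 * w)) by (apply Rmult_le_compat; lra).
  assert (A * (z * - z2) <= C * (1 * (2 * w))).
  { apply Rmult_le_compat; try lra; apply Rmult_le_pos; lra. }
  replace (- (A * (2 * (z1 ^ 2 + z * z2) * v ^ 2)))
    with ((2 * (A * (z * - z2)) - 2 * (A * z1 ^ 2)) * v ^ 2) by ring.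
  apply Rmult_le_compat_r; lra. }
(* the remaining terms are bounded by multiples of [v^2] and [u^2] *)
assert (Habs : forall p x y, Rabs p <= C -> 2 * (p * x * y) <= C * (x ^ 2 + y ^ 2)).
{ intros p x y Hp.
  apply Rle_trans with (2 * (C * (Rabs x * Rabs y))).
  - apply Rmult_le_compat_l; [lra|].
    apply Rle_trans with (1 := Rle_abs _); rewrite !Rabs_mult, Rmult_assoc.
    apply Rmult_le_compat_r; [|exact Hp].
    apply Rmult_le_pos; apply Rabs_pos.
  - rewrite <- (pow2_abs x), <- (pow2_abs y).
    assert (0 <= C * (Rabs x - Rabs y) ^ 2)
      by (apply Rmult_le_pos; [exact HC|apply pow2_ge_0]).
    nra. }
assert (Hzle : forall X, 0 <= X -> forall Y, Y <= X -> z ^ 2 * Y <= X).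
{ intros X HX Y HY; apply Rle_trans with (z ^ 2 * X);
    [apply Rmult_le_compat_l; assumption|].
  apply Rle_trans with (1 * X); [apply Rmult_le_compat_r; assumption|lra]. }
assert (T4 : z ^ 2 * (2 * (p1 * v * v)) <= C * (v ^ 2 + v ^ 2)).
{ apply Hzle; [apply Rmult_le_pos; lra|apply Habs, Hp1]. }
assert (T5 : z ^ 2 * (2 * (p0 * u * v)) <= C * (u ^ 2 + v ^ 2)).
{ apply Hzle; [apply Rmult_le_pos; lra|apply Habs, Hp0]. }
assert (T6 : 2 * (b1 * u * v) <= delta * v ^ 2 + e * u ^ 2).
{ apply Young_weighted; [exact Hd|]; rewrite He; apply Hsq, Hb1. }
assert (T6' : lam * (2 * (b1 * u * v)) <= lam * (delta * v ^ 2 + e * u ^ 2))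
  by (apply Rmult_le_compat_l; assumption).
assert (T7 : lam * (2 * (b0 * u * u)) <= lam * (C * (u ^ 2 + u ^ 2)))
  by (apply Rmult_le_compat_l; [assumption|apply Habs, Hb0]).
assert (T8 : lam * delta * v ^ 2 <= lam * A * v ^ 2).
{ apply Rmult_le_compat_r; [exact Hv2|]; apply Rmult_le_compat_l; lra. }
assert (T9 : u ^ 2 * (C + lam * (e + 2 * C)) <= B ^ 2 * (C + lam * (e + 2 * C))).
{ apply Rmult_le_compat_r; [|exact Hu2].
  apply Rplus_le_le_0_compat; [exact HC|]; apply Rmult_le_pos; lra. }
apply Rle_trans with (2 := T9).
assert (Ev : lam * delta * v ^ 2 = (e + 68 * C * w + 3 * C) * v ^ 2)
  by (rewrite Elam; ring).
lra.
Qed.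

(** Bernstein's method: if [u] solves a parabolic equation and so does
    [v = u_y], then [z^2 v^2 + lam u^2], with the cutoff [z = 1 - y^2 / r^2], is
    a subsolution up to a constant.  The bound on [v] in the half-size
    rectangle depends only on the listed constants. *)
Lemma bernstein_estimate : forall delta C B T r : R,
  0 < delta -> 0 <= C -> 0 <= B -> 0 <= T -> 0 < r ->
  exists K, 0 <= K /\
  forall (A b1 b0 p2 p1 p0 : R -> R) (u v v1 v2 : R -> R -> R),
  continuous_on (fun p : R * R => 0 <= fst p)
    (fun p : R * R => u (fst p) (snd p)) ->
  continuous_on (fun p : R * R => 0 <= fst p)
    (fun p : R * R => v (fst p) (snd p)) ->
  (forall t y, 0 < t <= T -> - r < y < r ->
     is_derive (u t) y (v t y) /\ is_derive (v t) y (v1 t y) /\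
     is_derive (v1 t) y (v2 t y)) ->
  (forall t y, 0 < t <= T -> - r < y < r ->
     is_derive (fun s => u s y) t
       (A y * v1 t y + b1 y * v t y + b0 y * u t y) /\
     is_derive (fun s => v s y) t
       (A y * v2 t y + p2 y * v1 t y + p1 y * v t y + p0 y * u t y)) ->
  (forall y, - r <= y <= r ->
     delta <= A y <= C /\ Rabs (b1 y) <= C /\ Rabs (b0 y) <= C /\
     Rabs (p2 y) <= C /\ Rabs (p1 y) <= C /\ Rabs (p0 y) <= C) ->
  (forall t y, 0 <= t <= T -> - r <= y <= r -> Rabs (u t y) <= B) ->
  (forall y, - r <= y <= r -> Rabs (v 0 y) <= B) ->
  forall t y, 0 <= t <= T -> - (r / 2) <= y <= r / 2 -> Rabs (v t y) <= K.
Proof.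
intros delta C B T r Hd HC HB HT Hr.
pose (w := 1 / r ^ 2).
assert (Hw : 0 < w) by (apply Rdiv_lt_0_compat; [lra|apply pow_lt, Hr]).
assert (Hwr : w * r ^ 2 = 1) by (unfold w; field; lra).
pose (lam := (C ^ 2 / delta + 68 * C * w + 3 * C) / delta).
assert (Hlam : 0 <= lam).
{ apply Rdiv_le_0_compat; [|exact Hd].
  assert (0 <= C ^ 2 / delta)
    by (apply Rdiv_le_0_compat; [apply pow2_ge_0|exact Hd]).
  assert (0 <= C * w) by (apply Rmult_le_pos; lra).
  lra. }
assert (Elam : lam * delta = C ^ 2 / delta + 68 * C * w + 3 * C)
  by (unfold lam; field; lra).
(* bounds the source term in the inequality for the auxiliary function, and [X]
   bounds that function itself *)
pose (S := B ^ 2 * (C + lam * (C ^ 2 / delta + 2 * C))).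
assert (HS : 0 <= S).
{ apply Rmult_le_pos; [apply pow2_ge_0|].
  assert (0 <= C ^ 2 / delta)
    by (apply Rdiv_le_0_compat; [apply pow2_ge_0|exact Hd]).
  assert (0 <= lam * (C ^ 2 / delta + 2 * C)) by (apply Rmult_le_pos; lra).
  lra. }
pose (X := B ^ 2 + lam * B ^ 2 + S * T).
assert (HX : 0 <= X).
{ unfold X; assert (HB2 := pow2_ge_0 B).
  assert (0 <= lam * B ^ 2) by (apply Rmult_le_pos; lra).
  assert (0 <= S * T) by (apply Rmult_le_pos; lra).
  lra. }
exists (1 + 2 * X); split; [lra|].
intros A b1 b0 p2 p1 p0 u v v1 v2 Cu Cv Hy Ht Hc Hu Hv0 t y Ht0 Hy0.
assert (Hsq : forall x, Rabs x <= B -> x ^ 2 <= B ^ 2).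
{ intros x Hx; rewrite <- (pow2_abs x); apply pow_incr; split;
    [apply Rabs_pos|exact Hx]. }
assert (Hzr : forall y, - r <= y <= r -> 0 <= 1 - w * y ^ 2 <= 1).
{ intros x Hx.
  assert (x ^ 2 <= r ^ 2) by nra.
  assert (w * x ^ 2 <= w * r ^ 2) by (apply Rmult_le_compat_l; lra).
  assert (0 <= w * x ^ 2) by (apply Rmult_le_pos; [lra|apply pow2_ge_0]).
  lra. }
assert (Hmain : (1 - w * y ^ 2) ^ 2 * v t y ^ 2 + lam * u t y ^ 2 <= X).
{ apply (parabolic_maximum_principle
    (fun t y => (1 - w * y ^ 2) ^ 2 * v t y ^ 2 + lam * u t y ^ 2)
    (fun t y => 2 * (1 - w * y ^ 2) ^ 2 * v t y
                * (A y * v2 t y + p2 y * v1 t y + p1 y * v t y + p0 y * u t y)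
                + 2 * lam * u t y
                * (A y * v1 t y + b1 y * v t y + b0 y * u t y))
    (fun t y => 2 * (1 - w * y ^ 2) * (- 2 * w * y) * v t y ^ 2
                + (1 - w * y ^ 2) ^ 2 * (2 * v t y * v1 t y)
                + lam * (2 * u t y * v t y))
    (fun t y => 2 * ((- 2 * w * y) ^ 2 + (1 - w * y ^ 2) * (- 2 * w)) * v t y ^ 2
                + 8 * (1 - w * y ^ 2) * (- 2 * w * y) * v t y * v1 t y
                + 2 * (1 - w * y ^ 2) ^ 2 * (v1 t y ^ 2 + v t y * v2 t y)
                + 2 * lam * (v t y ^ 2 + u t y * v1 t y))
    (fun t y => A y) T r (B ^ 2 + lam * B ^ 2) S); auto; try lra.
  - simpl.
    assert (Cz : continuous_on (fun p : R * R => 0 <= fst p)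
                   (fun p : R * R => 1 - w * (snd p * (snd p * 1)))).
    { intros p _; apply filterlim_comp with
        (F := within (fun p : R * R => 0 <= fst p) (locally p)) (f := @snd R R)
        (g := fun x => 1 - w * (x * (x * 1))) (G := locally (snd p)).
      - intros P HP; apply filter_le_within; apply (continuous_snd (fst p) (snd p)).
        destruct p; exact HP.
      - apply (ex_derive_continuous (fun x => 1 - w * (x * (x * 1)))).
        auto_derive; auto. }
    assert (C1 : forall k : R, continuous_on (fun p : R * R => 0 <= fst p)
                   (fun _ : R * R => k)) by (intros k p _; apply filterlim_const).
    pose (zc := fun p : R * R => 1 - w * (snd p * (snd p * 1))).
    change (continuous_on (fun p : R * R => 0 <= fst p) zc) in Cz.
    change (continuous_on (fun p : R * R => 0 <= fst p) (fun p : R * R =>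
      zc p * (zc p * 1) * (v (fst p) (snd p) * (v (fst p) (snd p) * 1))
      + lam * (u (fst p) (snd p) * (u (fst p) (snd p) * 1)))).
    apply continuous_on_plus_R; apply continuous_on_mult_R.
    + apply continuous_on_mult_R; [exact Cz|].
      apply continuous_on_mult_R; [exact Cz|apply C1].
    + apply continuous_on_mult_R; [exact Cv|].
      apply continuous_on_mult_R; [exact Cv|apply C1].
    + apply C1.
    + apply continuous_on_mult_R; [exact Cu|].
      apply continuous_on_mult_R; [exact Cu|apply C1].
  - intros s x Hs Hx; destruct (Hy s x Hs Hx) as [D1 [D2 D3]].
    destruct (Ht s x Hs Hx) as [E1 E2].
    destruct (Hc x ltac:(lra)) as [HA [H1 [H2 [H3 [H4 H5]]]]].
    assert (G1 : ex_derive (fun x : R => u s x) x) by (exists (v s x); exact D1).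
    assert (G2 : ex_derive (fun x : R => v s x) x) by (exists (v1 s x); exact D2).
    assert (G3 : ex_derive (fun x : R => v1 s x) x) by (exists (v2 s x); exact D3).
    split; [|split; [|split; [|split; [lra|]]]].
    + auto_derive.
      * repeat split; [exists (1 := E2)|exists (1 := E1)]; auto.
      * rewrite (is_derive_unique (fun z : R => u z x) _ _ E1).
        rewrite (is_derive_unique (fun z : R => v z x) _ _ E2); ring.
    + auto_derive.
      * repeat split; [exists (v1 s x); apply D2|exists (v s x); apply D1].
      * rewrite (is_derive_unique (fun x : R => v s x) _ _ D2).
        rewrite (is_derive_unique (fun x : R => u s x) _ _ D1); ring.
    + auto_derive.
      * repeat split; assumption.
      * rewrite (is_derive_unique (fun x : R => v s x) _ _ D2).
        rewrite (is_derive_unique (fun x : R => v1 s x) _ _ D3).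
        rewrite (is_derive_unique (fun x : R => u s x) _ _ D1); ring.
    + unfold S; apply bernstein_inequality with w; auto; try lra.
      * apply Hu; lra.
      * apply Hzr; lra.
      * replace ((-2 * w * x) ^ 2) with (4 * w * (w * x ^ 2)) by ring.
        rewrite <- (Rmult_1_r (4 * w)) at 2; apply Rmult_le_compat_l; [lra|].
        generalize (Hzr x ltac:(lra)); lra.
  - intros x Hx; assert (H1 := Hzr x Hx).
    assert (H2 := Hsq _ (Hv0 x Hx)).
    assert (H3 := Hsq _ (Hu 0 x ltac:(lra) Hx)).
    assert ((1 - w * x ^ 2) ^ 2 * v 0 x ^ 2 <= 1 * B ^ 2).
    { apply Rmult_le_compat; try apply pow2_ge_0; try exact H2.
      generalize (pow_incr _ 1 2 H1); rewrite pow1; auto. }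
    assert (lam * u 0 x ^ 2 <= lam * B ^ 2)
      by (apply Rmult_le_compat_l; assumption).
    lra.
  - intros s Hs.
    assert (HB2 := pow2_ge_0 B).
    assert (H3 : forall x, - r <= x <= r -> lam * u s x ^ 2 <= lam * B ^ 2).
    { intros x Hx; apply Rmult_le_compat_l; [exact Hlam|]; apply Hsq, Hu; auto. }
    assert (E : 1 - w * r ^ 2 = 0) by lra.
    assert (E' : 1 - w * (- r) ^ 2 = 0) by (rewrite <- E; ring).
    rewrite E, E'; generalize (H3 r ltac:(lra)) (H3 (- r) ltac:(lra)); lra. }
assert (Hz : 3 / 4 <= 1 - w * y ^ 2).
{ assert (y ^ 2 <= r ^ 2 / 4) by nra.
  assert (w * y ^ 2 <= w * (r ^ 2 / 4)) by (apply Rmult_le_compat_l; lra).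
  lra. }
assert (Hz2 : 9 / 16 <= (1 - w * y ^ 2) ^ 2) by nra.
assert (Hvv : 9 / 16 * v t y ^ 2 <= X).
{ assert (9 / 16 * v t y ^ 2 <= (1 - w * y ^ 2) ^ 2 * v t y ^ 2)
    by (apply Rmult_le_compat_r; [apply pow2_ge_0|exact Hz2]).
  assert (0 <= lam * u t y ^ 2)
    by (apply Rmult_le_pos; [exact Hlam|apply pow2_ge_0]).
  lra. }
rewrite <- (pow2_abs (v t y)) in Hvv.
assert (Ha := Rabs_pos (v t y)); nra.
Qed.

(** * Decay of the spatial derivatives of the solution *)

Lemma Rpower_le_1 : forall x a, 1 <= x -> a <= 0 -> Rpower x a <= 1.
Proof.
intros x a Hx Ha; rewrite <- (Rpower_O x) by lra.
apply Rle_Rpower; [exact Hx|exact Ha].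
Qed.

Lemma Rpower_ge_1 : forall x a, 1 <= x -> 0 <= a -> 1 <= Rpower x a.
Proof.
intros x a Hx Ha; rewrite <- (Rpower_O x) by lra.
apply Rle_Rpower; [exact Hx|exact Ha].
Qed.

Lemma Rpower_comparable : forall q x a, 0 < q -> q / 2 <= x <= 2 * q -> 0 <= a <= 1 ->
  Rpower q a / 2 <= Rpower x a <= 2 * Rpower q a.
Proof.
intros q x a Hq Hx Ha.
assert (Hp : 0 < Rpower q a) by apply exp_pos.
assert (H2 : Rpower 2 a <= 2).
{ rewrite <- (Rpower_1 2) at 2 by lra; apply Rle_Rpower; lra. }
assert (Hm : Rpower (2 * q) a <= 2 * Rpower q a).
{ rewrite <- Rpower_mult_distr by lra; apply Rmult_le_compat_r; lra. }
split.
- assert (Rpower q a <= 2 * Rpower (q / 2) a).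
  { replace q with (2 * (q / 2)) at 1 by field.
    rewrite <- Rpower_mult_distr by lra.
    apply Rmult_le_compat_r; [apply Rlt_le, exp_pos|exact H2]. }
  assert (Rpower (q / 2) a <= Rpower x a) by (apply Rle_Rpower_l; lra).
  lra.
- apply Rle_trans with (2 := Hm), Rle_Rpower_l; lra.
Qed.

Lemma Rpower_small : forall q a, 4 <= q -> 0 <= a <= 1 / 2 ->
  Rpower q a <= q / 2.
Proof.
intros q a Hq Ha.
apply Rle_trans with (Rpower q (/ 2)); [apply Rle_Rpower; lra|].
rewrite Rpower_sqrt by lra.
assert (H := sqrt_sqrt q ltac:(lra)).
assert (2 <= sqrt q).
{ rewrite <- (sqrt_Rsqr 2) by lra; apply sqrt_le_1; unfold Rsqr; lra. }
nra.
Qed.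

Lemma continuous_on_affine_rescale : forall (f : R -> R -> R) (k q s : R),
  0 < s ->
  continuous_on (fun p : R * R => 0 <= fst p)
    (fun p : R * R => f (fst p) (snd p)) ->
  continuous_on (fun p : R * R => 0 <= fst p)
    (fun p : R * R => k * f (fst p) (q + s * snd p)).
Proof.
intros f k q s Hs Hf.
apply (continuous_on_mult_R _ (fun _ => k)); [intros p _; apply filterlim_const|].
intros [t y] Ht P [e He]; unfold filtermap, within; simpl in *.
destruct (continuous_on_half_plane_eps f t (q + s * y) Hf Ht e (cond_pos e))
  as [d [Hd H]].
assert (Hds : 0 < d / s) by (apply Rdiv_lt_0_compat; assumption).
exists (mkposreal _ (Rmin_pos _ _ Hd Hds)); intros [u z] [Hu Hz] Hu0.
simpl in *; apply He.
change (Rabs (u - t) < Rmin d (d / s)) in Hu.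
change (Rabs (z - y) < Rmin d (d / s)) in Hz.
apply H; auto.
- apply Rlt_le_trans with (1 := Hu), Rmin_l.
- replace (q + s * z - (q + s * y)) with (s * (z - y)) by ring.
  rewrite Rabs_mult, (Rabs_pos_eq s) by lra.
  apply Rlt_le_trans with (2 := Req_le (s * (d / s)) d ltac:(field; lra)).
  apply Rmult_lt_compat_l; [exact Hs|].
  apply Rlt_le_trans with (1 := Hz), Rmin_r.
Qed.

Lemma Derive_n_family : forall (f : R -> R) (e : nat -> R -> R),
  (forall x, e 0%nat x = f x) ->
  (forall k x, is_derive (e k) x (e (S k) x)) ->
  forall k x, Derive_n f k x = e k x.
Proof.
intros f e H0 Hd k; induction k as [|k IH]; intros x; [simpl; auto|].
simpl; rewrite (Derive_ext _ (e k) x IH).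
apply is_derive_unique, Hd.
Qed.

Lemma smooth_is_derive : forall (f : R -> R) (k : nat) (x : R),
  smooth f -> is_derive (Derive_n f k) x (Derive_n f (S k) x).
Proof. intros f k x Hf; apply Derive_correct, (Hf (S k) x). Qed.

(** The family [d] of partial derivatives in [smooth_half_plane]. *)
Definition partials (c : R -> R -> R) (d : nat -> nat -> R -> R -> R) : Prop :=
  (forall t q, 0 <= t -> d 0%nat 0%nat t q = c t q) /\
  (forall i j,
      continuous_on (fun p : R * R => 0 <= fst p)
                    (fun p : R * R => d i j (fst p) (snd p)) /\
      (forall t q, 0 <= t ->
         is_derive_on Rplus_set (fun s => d i j s q) t (d (S i) j t q) /\
         is_derive (fun x => d i j t x) q (d i (S j) t q))).

Section Decay.

Variables (sigma c0 : R -> R) (c : R -> R -> R) (d : nat -> nat -> R -> R -> R).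
Hypothesis hc : bounded_smooth_solution sigma c0 c.
Hypothesis hd : partials c d.
Hypothesis hs : smooth sigma.

Let sg k := Derive_n sigma k.

Lemma partials_pde : forall t q, 0 <= t ->
  d 1 0 t q = 1 / 2 * (sigma q) ^ 2 * d 0%nat 2%nat t q.
Proof.
intros t q Ht.
apply is_derive_on_unique with (fun s => c s q) t; [exact Ht| |].
- apply is_derive_on_ext with (fun s => d 0%nat 0%nat s q); [exact Ht| |].
  + intros s Hs; apply (proj1 hd); exact Hs.
  + apply (proj2 hd 0%nat 0%nat); exact Ht.
- replace (d 0%nat 2%nat t q) with (Derive_n (fun x => c t x) 2 q).
  + apply (solution_pde _ _ _ hc); exact Ht.
  + apply (Derive_n_family _ (fun k => d 0%nat k t)).
    * intros x; apply (proj1 hd); exact Ht.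
    * intros k x; apply (proj2 hd 0%nat k); exact Ht.
Qed.

Lemma partials_initial : forall k q, d 0%nat k 0 q = Derive_n c0 k q.
Proof.
intros k q; symmetry; apply (Derive_n_family _ (fun k => d 0%nat k 0)).
- intros x; rewrite (proj1 hd) by lra; apply (solution_initial _ _ _ hc).
- intros j x; apply (proj2 hd 0%nat j); lra.
Qed.

(** The equation differentiated in [q]: once here, twice and three times in the
    next two lemmas. *)
Lemma partials_pde_1 : forall t q, 0 <= t ->
  d 1 1 t q = sigma q * sg 1 q * d 0%nat 2%nat t q
              + 1 / 2 * (sigma q) ^ 2 * d 0%nat 3%nat t q.
Proof.
intros t q Ht.
assert (H : is_derive (d 1%nat 0%nat t) q (d 1%nat 1%nat t q))
  by (apply (proj2 hd 1%nat 0%nat); exact Ht).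
rewrite <- (is_derive_unique _ _ _ H).
rewrite (Derive_ext _ _ q (fun q => partials_pde t q Ht)).
apply is_derive_unique.
assert (D2 : is_derive (fun x => d 0%nat 2%nat t x) q (d 0%nat 3%nat t q))
  by (apply (proj2 hd 0%nat 2%nat); exact Ht).
assert (S0 : is_derive (fun x : R => sigma x) q (sg 1 q))
  by (apply (smooth_is_derive sigma 0); exact hs).
auto_derive.
- split; [exists (1 := S0)|split; [exists (1 := D2)|]]; auto.
- rewrite (is_derive_unique (fun x : R => sigma x) _ _ S0).
  rewrite (is_derive_unique (fun x : R => d 0%nat 2%nat t x) _ _ D2); field.
Qed.

Lemma partials_pde_2 : forall t q, 0 <= t ->
  d 1 2 t q = (sg 1 q ^ 2 + sigma q * sg 2 q) * d 0%nat 2%nat t q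
              + 2 * (sigma q * sg 1 q) * d 0%nat 3%nat t q
              + 1 / 2 * (sigma q) ^ 2 * d 0%nat 4%nat t q.
Proof.
intros t q Ht.
assert (H : is_derive (d 1%nat 1%nat t) q (d 1%nat 2%nat t q))
  by (apply (proj2 hd 1%nat 1%nat); exact Ht).
rewrite <- (is_derive_unique _ _ _ H).
rewrite (Derive_ext _ _ q (fun q => partials_pde_1 t q Ht)).
apply is_derive_unique.
assert (D2 : is_derive (fun x => d 0%nat 2%nat t x) q (d 0%nat 3%nat t q))
  by (apply (proj2 hd 0%nat 2%nat); exact Ht).
assert (D3 : is_derive (fun x => d 0%nat 3%nat t x) q (d 0%nat 4%nat t q))
  by (apply (proj2 hd 0%nat 3%nat); exact Ht).
assert (S0 : is_derive (fun x : R => sigma x) q (sg 1 q))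
  by (apply (smooth_is_derive sigma 0); exact hs).
assert (S1 : is_derive (fun x : R => sg 1 x) q (sg 2 q))
  by (apply (smooth_is_derive sigma 1); exact hs).
assert (G1 := ex_intro _ _ D2 : ex_derive (fun x => d 0%nat 2%nat t x) q).
assert (G2 := ex_intro _ _ D3 : ex_derive (fun x => d 0%nat 3%nat t x) q).
assert (G3 := ex_intro _ _ S0 : ex_derive (fun x : R => sigma x) q).
assert (G4 := ex_intro _ _ S1 : ex_derive (fun x : R => sg 1 x) q).
auto_derive.
- repeat split; assumption.
- rewrite (is_derive_unique (fun x : R => sigma x) _ _ S0).
  rewrite (is_derive_unique (fun x : R => sg 1 x) _ _ S1).
  rewrite (is_derive_unique (fun x : R => d 0%nat 2%nat t x) _ _ D2).
  rewrite (is_derive_unique (fun x : R => d 0%nat 3%nat t x) _ _ D3); field.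
Qed.

Lemma partials_pde_3 : forall t q, 0 <= t ->
  d 1 3 t q = (3 * (sg 1 q * sg 2 q) + sigma q * sg 3 q) * d 0%nat 2%nat t q
              + 3 * (sg 1 q ^ 2 + sigma q * sg 2 q) * d 0%nat 3%nat t q
              + 3 * (sigma q * sg 1 q) * d 0%nat 4%nat t q
              + 1 / 2 * (sigma q) ^ 2 * d 0%nat 5%nat t q.
Proof.
intros t q Ht.
assert (H : is_derive (d 1%nat 2%nat t) q (d 1%nat 3%nat t q))
  by (apply (proj2 hd 1%nat 2%nat); exact Ht).
rewrite <- (is_derive_unique _ _ _ H).
rewrite (Derive_ext _ _ q (fun q => partials_pde_2 t q Ht)).
apply is_derive_unique.
assert (D2 : is_derive (fun x => d 0%nat 2%nat t x) q (d 0%nat 3%nat t q))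
  by (apply (proj2 hd 0%nat 2%nat); exact Ht).
assert (D3 : is_derive (fun x => d 0%nat 3%nat t x) q (d 0%nat 4%nat t q))
  by (apply (proj2 hd 0%nat 3%nat); exact Ht).
assert (D4 : is_derive (fun x => d 0%nat 4%nat t x) q (d 0%nat 5%nat t q))
  by (apply (proj2 hd 0%nat 4%nat); exact Ht).
assert (S0 : is_derive (fun x : R => sigma x) q (sg 1 q))
  by (apply (smooth_is_derive sigma 0); exact hs).
assert (S1 : is_derive (fun x : R => sg 1 x) q (sg 2 q))
  by (apply (smooth_is_derive sigma 1); exact hs).
assert (S2 : is_derive (fun x : R => sg 2 x) q (sg 3 q))
  by (apply (smooth_is_derive sigma 2); exact hs).
assert (G1 := ex_intro _ _ D2 : ex_derive (fun x => d 0%nat 2%nat t x) q).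
assert (G2 := ex_intro _ _ D3 : ex_derive (fun x => d 0%nat 3%nat t x) q).
assert (G3 := ex_intro _ _ D4 : ex_derive (fun x => d 0%nat 4%nat t x) q).
assert (G4 := ex_intro _ _ S0 : ex_derive (fun x : R => sigma x) q).
assert (G5 := ex_intro _ _ S1 : ex_derive (fun x : R => sg 1 x) q).
assert (G6 := ex_intro _ _ S2 : ex_derive (fun x : R => sg 2 x) q).
auto_derive.
- repeat split; assumption.
- rewrite (is_derive_unique (fun x : R => sigma x) _ _ S0).
  rewrite (is_derive_unique (fun x : R => sg 1 x) _ _ S1).
  rewrite (is_derive_unique (fun x : R => sg 2 x) _ _ S2).
  rewrite (is_derive_unique (fun x : R => d 0%nat 2%nat t x) _ _ D2).
  rewrite (is_derive_unique (fun x : R => d 0%nat 3%nat t x) _ _ D3).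
  rewrite (is_derive_unique (fun x : R => d 0%nat 4%nat t x) _ _ D4); field.
Qed.

End Decay.

(** On [[q/2, 2q]] the [k]-th derivative of [sigma] is [O(s^(1-k))], where
    [s = q^(gamma/2)]: this is weaker than the assumed decay [x^(gamma/2-k)], but
    it is the form invariant under the zoom of ratio [s] used below. *)
Lemma sigma_scaled_bounds :
  forall (C1 gamma M : R) (alpha beta sigma sigma0 sigmab : R -> R),
  0 <= gamma <= 1 / 2 ->
  diffusion_assumption C1 gamma M alpha beta sigma sigma0 sigmab ->
  exists delta L, 0 < delta /\ 0 <= L /\
  forall q x, 4 <= q -> q / 2 <= x <= 2 * q ->
    delta * Rpower q (gamma / 2) <= sigma x <= L * Rpower q (gamma / 2) /\
    Rabs (Derive_n sigma 1 x) <= L /\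
    Rabs (Derive_n sigma 2 x) * Rpower q (gamma / 2) <= L /\
    Rabs (Derive_n sigma 3 x) * Rpower q (gamma / 2) ^ 2 <= L.
Proof.
intros C1 gamma M alpha beta sigma sigma0 sigmab Hg H.
destruct (sigmab_bounds _ _ _ _ _ _ _ _ H) as [dm [dp [Hdm [Hdp Hb]]]].
destruct (sigma_decay _ _ _ _ _ _ _ _ H 1%nat ltac:(lia)) as [S1 [HS1 B1]].
destruct (sigma_decay _ _ _ _ _ _ _ _ H 2%nat ltac:(lia)) as [S2 [HS2 B2]].
destruct (sigma_decay _ _ _ _ _ _ _ _ H 3%nat ltac:(lia)) as [S3 [HS3 B3]].
exists (dm / 2), (2 * dp + S1 + 2 * S2 + 4 * S3).
split; [lra|]; split; [lra|].
intros q x Hq Hx.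
assert (Hs : 0 < Rpower q (gamma / 2)) by apply exp_pos.
destruct (Rpower_comparable q x (gamma / 2)) as [Hr1 Hr2]; try lra.
assert (Hr : 0 < Rpower x (gamma / 2)) by apply exp_pos.
assert (Hx1 : 1 <= Rabs x) by (rewrite Rabs_pos_eq; lra).
specialize (B1 x Hx1); specialize (B2 x Hx1); specialize (B3 x Hx1).
assert (Hsig := sigma_factor _ _ _ _ _ _ _ _ H x).
rewrite (sigma0_far _ _ _ _ _ _ _ _ H x Hx1) in Hsig.
rewrite (Rabs_pos_eq x) in B1, B2, B3, Hsig by lra.
assert (E1 : Rpower x (gamma / 2 - INR 1) <= 1)
  by (apply Rpower_le_1; [lra|simpl; lra]).
assert (E2 : Rpower x (gamma / 2 - INR 2) * Rpower x (gamma / 2) <= 1).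
{ rewrite <- Rpower_plus; apply Rpower_le_1; [lra|simpl; lra]. }
assert (E3 : Rpower x (gamma / 2 - INR 3) * Rpower x (gamma / 2) ^ 2 <= 1).
{ simpl pow; rewrite Rmult_1_r, <- !Rpower_plus.
  apply Rpower_le_1; [lra|simpl; lra]. }
set (s := Rpower q (gamma / 2)) in *; set (rho := Rpower x (gamma / 2)) in *.
assert (Hrho2 : s ^ 2 <= 4 * rho ^ 2) by nra.
specialize (Hb x).
split; [split|].
- rewrite Hsig; apply Rle_trans with (rho * dm); [nra|].
  apply Rmult_le_compat_l; lra.
- rewrite Hsig; apply Rle_trans with (rho * dp);
    [apply Rmult_le_compat_l; lra|].
  assert (0 <= (S1 + 2 * S2 + 4 * S3) * s) by (apply Rmult_le_pos; lra).
  assert (rho * dp <= 2 * s * dp) by (apply Rmult_le_compat_r; lra).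
  lra.
- split; [|split].
  + apply Rle_trans with (1 := B1).
    assert (S1 * Rpower x (gamma / 2 - INR 1) <= S1 * 1)
      by (apply Rmult_le_compat_l; lra).
    lra.
  + apply Rle_trans with (S2 * Rpower x (gamma / 2 - INR 2) * (2 * rho)).
    * apply Rmult_le_compat; try lra; apply Rabs_pos.
    * assert (S2 * (Rpower x (gamma / 2 - INR 2) * rho) <= S2 * 1)
        by (apply Rmult_le_compat_l; lra).
      lra.
  + apply Rle_trans with (S3 * Rpower x (gamma / 2 - INR 3) * (4 * rho ^ 2)).
    * apply Rmult_le_compat; try lra; [apply Rabs_pos|apply pow2_ge_0].
    * assert (S3 * (Rpower x (gamma / 2 - INR 3) * rho ^ 2) <= S3 * 1)
        by (apply Rmult_le_compat_l; lra).
      lra.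
Qed.

Lemma Rabs_mult_le : forall x y X Y, Rabs x <= X -> Rabs y <= Y ->
  Rabs (x * y) <= X * Y.
Proof.
intros x y X Y Hx Hy; rewrite Rabs_mult.
apply Rmult_le_compat; auto; apply Rabs_pos.
Qed.

Lemma Rabs_plus_le : forall x y X Y, Rabs x <= X -> Rabs y <= Y ->
  Rabs (x + y) <= X + Y.
Proof. intros x y X Y Hx Hy; generalize (Rabs_triang x y); lra. Qed.

(** Zoom at [q] with the diffusive length [s = q^(gamma/2)]: the rescaled
    functions [s^k d_q^k c (t, q + s y)] satisfy uniformly parabolic equations on
    [|y| <= 1] with bounds independent of [q], so that [bernstein_estimate],
    applied three times on shrinking intervals, controls them at [y = 0]. *)
Lemma solution_derivative_decay :
  forall (C1 gamma M T : R) (alpha beta sigma sigma0 sigmab c0 : R -> R)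
    (c : R -> R -> R) (d : nat -> nat -> R -> R -> R),
  0 <= gamma <= 1 / 2 -> 0 <= T ->
  diffusion_assumption C1 gamma M alpha beta sigma sigma0 sigmab ->
  initial_assumption sigma0 c0 ->
  bounded_smooth_solution sigma c0 c -> partials c d ->
  exists K, 0 <= K /\ forall t q, 0 <= t <= T -> 4 <= q ->
    Rabs (d 0%nat 0%nat t q) <= K /\
    Rpower q (gamma / 2) * Rabs (d 0%nat 1%nat t q) <= K /\
    Rpower q (gamma / 2) ^ 2 * Rabs (d 0%nat 2%nat t q) <= K /\
    Rpower q (gamma / 2) ^ 3 * Rabs (d 0%nat 3%nat t q) <= K.
Proof.
intros C1 gamma M T alpha beta sigma sigma0 sigmab c0 c d Hg HT Hs Hi Hc Hd.
destruct (sigma_scaled_bounds _ _ _ _ _ _ _ _ Hg Hs)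
  as [delta [L [Hdelta [HL Hsb]]]].
destruct (solution_bounded _ _ _ Hc) as [B0' HB0'].
assert (HB0 : forall t q, 0 <= t -> Rabs (c t q) <= Rabs B0').
{ intros t q Ht; apply Rle_trans with (1 := HB0' t q Ht), Rle_abs. }
destruct (c0_derivatives _ _ Hi 1%nat ltac:(lia)) as [R1 [HR1 I1]].
destruct (c0_derivatives _ _ Hi 2%nat ltac:(lia)) as [R2 [HR2 I2]].
destruct (c0_derivatives _ _ Hi 3%nat ltac:(lia)) as [R3 [HR3 I3]].
(* bounds the rescaled initial derivatives: the weights at [q] and at nearby
   points differ by a factor of at most [2] *)
pose (R0 := 2 * R1 + 4 * R2 + 8 * R3).
pose (de := delta ^ 2 / 2).
assert (Hde : 0 < de).
{ unfold de; assert (0 < delta ^ 2) by (apply pow_lt, Hdelta); lra. }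
pose (Cc := 12 * L ^ 2).
assert (HL2 := pow2_ge_0 L).
assert (HCc : 0 <= Cc) by (unfold Cc; lra).
assert (HBB := Rabs_pos B0').
destruct (bernstein_estimate de Cc (Rabs B0' + R0) T 1) as [K1 [HK1 E1]];
  try (unfold R0; lra).
destruct (bernstein_estimate de Cc (K1 + R0) T (1 / 2)) as [K2 [HK2 E2]];
  try (unfold R0; lra).
destruct (bernstein_estimate de Cc (K2 + R0) T (1 / 2 / 2)) as [K3 [HK3 E3]];
  try (unfold R0; lra).
exists (Rabs B0' + K1 + K2 + K3); split; [lra|].
intros t q Ht Hq.
pose (s := Rpower q (gamma / 2)); fold s.
assert (Hs1 : 1 <= s) by (apply Rpower_ge_1; lra).
assert (Hs2 : s <= q / 2) by (apply Rpower_small; lra).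
assert (Hball : forall y, - 1 <= y <= 1 -> q / 2 <= q + s * y <= 2 * q) by (intros; nra).
pose (w := fun k t y => s ^ k * d 0%nat k t (q + s * y)).
assert (Cw : forall k, continuous_on (fun p : R * R => 0 <= fst p)
                         (fun p : R * R => w k (fst p) (snd p))).
{ intros k; apply continuous_on_affine_rescale; [lra|apply (proj2 Hd 0%nat k)]. }
assert (Dy : forall k t y, 0 <= t -> is_derive (w k t) y (w (S k) t y)).
{ intros k t' y Ht'.
  assert (H : is_derive (d 0%nat k t') (q + s * y) (d 0%nat (S k) t' (q + s * y)))
    by (apply (proj2 Hd 0%nat k); exact Ht').
  unfold w.
  replace (s ^ S k * d 0%nat (S k) t' (q + s * y))
    with (s ^ k * (s * d 0%nat (S k) t' (q + s * y))) by (simpl; ring).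
  apply is_derive_scal.
  apply (is_derive_comp (d 0%nat k t') (fun y => q + s * y)); [exact H|].
  auto_derive; auto; ring. }
assert (Dt : forall k t y l, 0 < t -> s ^ k * d 1%nat k t (q + s * y) = l ->
          is_derive (fun s => w k s y) t l).
{ intros k t' y l Ht' <-; unfold w; apply is_derive_scal.
  apply is_derive_on_half_line_pos; [exact Ht'|].
  apply (proj2 Hd 0%nat k); lra. }
pose (A0 := fun y => sigma (q + s * y) ^ 2 / (2 * s ^ 2)).
pose (A1 := fun y => sigma (q + s * y) * Derive_n sigma 1 (q + s * y) / s).
pose (A2 := fun y => Derive_n sigma 1 (q + s * y) ^ 2
                     + sigma (q + s * y) * Derive_n sigma 2 (q + s * y)).
pose (A3 := fun y => s * (3 * (Derive_n sigma 1 (q + s * y)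
                               * Derive_n sigma 2 (q + s * y))
                     + sigma (q + s * y) * Derive_n sigma 3 (q + s * y))).
assert (HA : forall y, -1 <= y <= 1 ->
  de <= A0 y <= Cc /\ Rabs (A1 y) <= L ^ 2 /\ Rabs (A2 y) <= 2 * L ^ 2 /\
  Rabs (A3 y) <= 4 * L ^ 2).
{ intros y Hy; destruct (Hsb q _ Hq (Hball y Hy)) as [[G1 G2] [G3 [G4 G5]]].
  fold s in G1, G2, G4, G5; unfold A0, A1, A2, A3.
  set (x := q + s * y) in *.
  assert (Hds : 0 <= delta * s) by (apply Rmult_le_pos; lra).
  assert (Hss : 0 < s ^ 2) by (apply pow_lt; lra).
  assert (G6 : Rabs (sigma x / s) <= L).
  { unfold Rdiv; rewrite Rabs_mult, Rabs_inv, (Rabs_pos_eq s) by lra.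
    rewrite Rabs_pos_eq by lra.
    apply Rmult_le_reg_r with s; [lra|]; rewrite Rmult_assoc, Rinv_l by lra; lra. }
  assert (G7 : Rabs (s * Derive_n sigma 2 x) <= L).
  { rewrite Rabs_mult, (Rabs_pos_eq s) by lra; lra. }
  assert (G8 : Rabs (s ^ 2 * Derive_n sigma 3 x) <= L).
  { rewrite Rabs_mult, (Rabs_pos_eq (s ^ 2)) by lra; lra. }
  split; [split|split; [|split]].
  - unfold de; apply Rmult_le_reg_r with (2 * s ^ 2); [lra|].
    replace (sigma x ^ 2 / (2 * s ^ 2) * (2 * s ^ 2)) with (sigma x ^ 2)
      by (field; lra).
    replace (delta ^ 2 / 2 * (2 * s ^ 2)) with ((delta * s) ^ 2) by field.
    apply pow_incr; lra.
  - unfold Cc; apply Rmult_le_reg_r with (2 * s ^ 2); [lra|].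
    replace (sigma x ^ 2 / (2 * s ^ 2) * (2 * s ^ 2)) with (sigma x ^ 2)
      by (field; lra).
    assert (sigma x ^ 2 <= (L * s) ^ 2) by (apply pow_incr; lra).
    assert (0 <= L ^ 2 * s ^ 2) by (apply Rmult_le_pos; lra).
    nra.
  - replace (sigma x * Derive_n sigma 1 x / s)
      with (sigma x / s * Derive_n sigma 1 x) by (field; lra).
    replace (L ^ 2) with (L * L) by ring; apply Rabs_mult_le; assumption.
  - replace (2 * L ^ 2) with (L * L + L * L) by ring.
    apply Rabs_plus_le.
    + replace (Derive_n sigma 1 x ^ 2) with (Derive_n sigma 1 x * Derive_n sigma 1 x)
        by ring; apply Rabs_mult_le; assumption.
    + replace (sigma x * Derive_n sigma 2 x)
        with (sigma x / s * (s * Derive_n sigma 2 x)) by (field; lra).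
      apply Rabs_mult_le; assumption.
  - replace (s * (3 * (Derive_n sigma 1 x * Derive_n sigma 2 x)
                  + sigma x * Derive_n sigma 3 x))
      with (3 * (Derive_n sigma 1 x * (s * Derive_n sigma 2 x))
            + sigma x / s * (s ^ 2 * Derive_n sigma 3 x)) by (field; lra).
    replace (4 * L ^ 2) with (3 * (L * L) + L * L) by ring.
    apply Rabs_plus_le; apply Rabs_mult_le; try assumption.
    + rewrite Rabs_pos_eq; lra.
    + apply Rabs_mult_le; assumption. }
assert (Hini : forall k R, (forall x, Rabs (Derive_n c0 k x * sigma0 x ^ k) <= R) ->
  forall y, -1 <= y <= 1 -> Rabs (w k 0 y) <= 2 ^ k * R).
{ intros k R HR y Hy; specialize (HR (q + s * y)).
  assert (Hx := Hball y Hy); set (x := q + s * y) in *.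
  unfold w; fold x; rewrite (partials_initial _ _ _ _ Hc Hd).
  assert (Hx1 : 1 <= Rabs x) by (rewrite Rabs_pos_eq; lra).
  rewrite (sigma0_far _ _ _ _ _ _ _ _ Hs x Hx1) in HR.
  rewrite (Rabs_pos_eq x) in HR by lra.
  destruct (Rpower_comparable q x (gamma / 2)) as [Hr1 Hr2]; try lra.
  fold s in Hr1.
  rewrite Rabs_mult, Rabs_pos_eq by (apply pow_le; lra).
  rewrite Rabs_mult in HR.
  rewrite (Rabs_pos_eq (_ ^ k)) in HR by (apply pow_le; lra).
  apply Rle_trans with ((2 * Rpower x (gamma / 2)) ^ k * Rabs (Derive_n c0 k x)).
  - apply Rmult_le_compat_r; [apply Rabs_pos|]; apply pow_incr; lra.
  - rewrite Rpow_mult_distr, Rmult_assoc; apply Rmult_le_compat_l;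
      [apply pow_le; lra|lra]. }
assert (Hini1 := Hini 1%nat R1 I1); assert (Hini2 := Hini 2%nat R2 I2).
assert (Hini3 := Hini 3%nat R3 I3); simpl in Hini1, Hini2, Hini3.
assert (Hs0 : s <> 0) by lra.
assert (W0 : forall t y, 0 <= t -> Rabs (w 0%nat t y) <= Rabs B0').
{ intros t' y Ht'; unfold w; rewrite pow_O, Rmult_1_l, (proj1 Hd) by exact Ht'.
  apply HB0, Ht'. }
assert (Z0 : Rabs 0 <= Cc) by (rewrite Rabs_R0; exact HCc).
assert (Zm : forall k x X, 0 <= k -> Rabs x <= X -> k * X <= Cc -> Rabs (k * x) <= Cc).
{ intros k x X Hk Hx HX; rewrite Rabs_mult, (Rabs_pos_eq k) by exact Hk.
  apply Rle_trans with (2 := HX), Rmult_le_compat_l; assumption. }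
assert (W1 : forall t y, 0 <= t <= T -> - (1 / 2) <= y <= 1 / 2 ->
          Rabs (w 1%nat t y) <= K1).
{ apply (E1 A0 (fun _ => 0) (fun _ => 0) A1 (fun _ => 0) (fun _ => 0)
           (w 0%nat) (w 1%nat) (w 2%nat) (w 3%nat)); auto.
  - intros t' y Ht' Hy; repeat split; apply Dy; lra.
  - intros t' y Ht' Hy; split; (apply Dt; [lra|]).
    + rewrite (partials_pde _ _ _ _ Hc Hd) by lra; unfold w, A0; field; exact Hs0.
    + rewrite (partials_pde_1 _ _ _ _ Hc Hd (sigma_smooth _ _ _ _ _ _ _ _ Hs)) by lra.
      unfold w, A0, A1; field; exact Hs0.
  - intros y Hy; destruct (HA y Hy) as [G1 [G2 [G3 G4]]].
    repeat split; try assumption; try lra; unfold Cc; lra.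
  - intros t' y Ht' _; generalize (W0 t' y (proj1 Ht')); unfold R0; lra.
  - intros y Hy; generalize (Hini1 y Hy); unfold R0; lra. }
assert (W2 : forall t y, 0 <= t <= T -> - (1 / 2 / 2) <= y <= 1 / 2 / 2 ->
          Rabs (w 2%nat t y) <= K2).
{ apply (E2 A0 A1 (fun _ => 0) (fun y => 2 * A1 y) A2 (fun _ => 0)
           (w 1%nat) (w 2%nat) (w 3%nat) (w 4%nat)); auto.
  - intros t' y Ht' Hy; repeat split; apply Dy; lra.
  - intros t' y Ht' Hy; split; (apply Dt; [lra|]).
    + rewrite (partials_pde_1 _ _ _ _ Hc Hd (sigma_smooth _ _ _ _ _ _ _ _ Hs)) by lra.
      unfold w, A0, A1; field; exact Hs0.
    + rewrite (partials_pde_2 _ _ _ _ Hc Hd (sigma_smooth _ _ _ _ _ _ _ _ Hs)) by lra.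
      unfold w, A0, A1, A2; field; exact Hs0.
  - intros y Hy; destruct (HA y ltac:(lra)) as [G1 [G2 [G3 G4]]].
    repeat split; try assumption; try lra; try (unfold Cc; lra).
    apply (Zm 2 _ _ ltac:(lra) G2); unfold Cc; lra.
  - intros t' y Ht' Hy; generalize (W1 t' y Ht' Hy); unfold R0; lra.
  - intros y Hy; generalize (Hini2 y ltac:(lra)); unfold R0; lra. }
assert (W3 : forall t y, 0 <= t <= T -> - (1 / 2 / 2 / 2) <= y <= 1 / 2 / 2 / 2 ->
          Rabs (w 3%nat t y) <= K3).
{ apply (E3 A0 (fun y => 2 * A1 y) A2 (fun y => 3 * A1 y) (fun y => 3 * A2 y) A3
           (w 2%nat) (w 3%nat) (w 4%nat) (w 5%nat)); auto.
  - intros t' y Ht' Hy; repeat split; apply Dy; lra.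
  - intros t' y Ht' Hy; split; (apply Dt; [lra|]).
    + rewrite (partials_pde_2 _ _ _ _ Hc Hd (sigma_smooth _ _ _ _ _ _ _ _ Hs)) by lra.
      unfold w, A0, A1, A2; field; exact Hs0.
    + rewrite (partials_pde_3 _ _ _ _ Hc Hd (sigma_smooth _ _ _ _ _ _ _ _ Hs)) by lra.
      unfold w, A0, A1, A2, A3; field; exact Hs0.
  - intros y Hy; destruct (HA y ltac:(lra)) as [G1 [G2 [G3 G4]]].
    repeat split; try assumption; try lra; try (unfold Cc; lra).
    + apply (Zm 2 _ _ ltac:(lra) G2); unfold Cc; lra.
    + apply (Zm 3 _ _ ltac:(lra) G2); unfold Cc; lra.
    + apply (Zm 3 _ _ ltac:(lra) G3); unfold Cc; lra.
  - intros t' y Ht' Hy; generalize (W2 t' y Ht' Hy); unfold R0; lra.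
  - intros y Hy; generalize (Hini3 y ltac:(lra)); unfold R0; lra. }
specialize (W0 t 0 (proj1 Ht)); specialize (W1 t 0 Ht ltac:(lra)).
specialize (W2 t 0 Ht ltac:(lra)); specialize (W3 t 0 Ht ltac:(lra)).
unfold w in W0, W1, W2, W3; rewrite Rmult_0_r, Rplus_0_r in W0, W1, W2, W3.
rewrite Rabs_mult, Rabs_pos_eq in W0, W1, W2, W3 by (apply pow_le; lra).
rewrite pow_O, Rmult_1_l in W0; rewrite pow_1 in W1.
repeat split; lra.
Qed.

(** * The characteristics [Q] *)

(** The family of derivatives in [smooth_on Rplus_set]. *)
Definition half_line_derivatives (f : R -> R) (d : nat -> R -> R) : Prop :=
  (forall x, 0 <= x -> d 0%nat x = f x) /\
  (forall k x, 0 <= x -> is_derive_on Rplus_set (d k) x (d (S k) x)).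

Lemma locally_pos : forall x, 0 < x -> locally x (fun y => 0 < y).
Proof.
intros x Hx; exists (mkposreal x Hx); intros y Hy.
change (Rabs (y - x) < x) in Hy; apply Rabs_def2 in Hy; lra.
Qed.

Lemma half_line_is_derive : forall (f : R -> R) (d : nat -> R -> R) (x : R),
  half_line_derivatives f d -> 0 < x -> is_derive f x (d 1%nat x).
Proof.
intros f d x [H0 Hd] Hx.
apply is_derive_ext_loc with (d 0%nat).
- generalize (locally_pos x Hx); apply filter_imp; intros y Hy; apply H0; lra.
- apply is_derive_on_interior with Rplus_set; [|apply Hd; lra].
  generalize (locally_pos x Hx); apply filter_imp; intros y Hy.
  unfold Rplus_set; lra.
Qed.

Lemma rate_derivatives : forall gamma a, rate gamma a ->
  exists d, half_line_derivatives a d.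
Proof. intros gamma a H; exact (rate_smooth _ _ H). Qed.

Section Characteristics.

Variables (C1 gamma M : R) (alpha beta : R -> R).
Hypothesis hr : rates_assumption C1 gamma M alpha beta.

Let F := F C1 alpha beta.
Let G := G C1 M alpha beta.
Let Q := Q C1 M alpha beta.

Lemma F_continuous : forall x, 0 < x -> continuous F x.
Proof.
intros x Hx.
destruct (rate_derivatives _ _ (alpha_rate _ _ _ _ _ hr)) as [da Ha].
destruct (rate_derivatives _ _ (beta_rate _ _ _ _ _ hr)) as [db Hb].
apply (ex_derive_continuous F).
assert (Ga : ex_derive (fun x : R => alpha x) x)
  by (exists (da 1%nat x); apply half_line_is_derive; assumption).
assert (Gb : ex_derive (fun x : R => beta x) x)
  by (exists (db 1%nat x); apply half_line_is_derive; assumption).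
unfold F, Defs.F; auto_derive; auto.
Qed.

Lemma F_le : forall x y, M <= x -> x <= y -> F x <= F y.
Proof.
intros x y Hx Hxy; destruct (Rle_lt_or_eq_dec x y Hxy) as [Hlt|<-].
- apply Rlt_le, (F_incr _ _ _ _ _ hr); assumption.
- apply Rle_refl.
Qed.

Lemma F_gt_0 : forall x, M <= x -> 0 < F x.
Proof. exact (F_pos _ _ _ _ _ hr). Qed.

Lemma ex_RInt_inv_F : forall x y, M <= x -> x <= y ->
  ex_RInt (fun y => / F y) x y.
Proof.
intros x y Hx Hxy; apply (ex_RInt_continuous (fun y => / F y)).
rewrite Rmin_left, Rmax_right by assumption; intros z Hz.
assert (HM := M_pos _ _ _ _ _ hr).
apply (continuous_comp F Rinv); [apply F_continuous; lra|].
apply continuous_Rinv; generalize (F_gt_0 z ltac:(lra)); lra.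
Qed.

(** Since [F] is increasing, the mean of [1 / F] lies between its end values. *)
Lemma G_increment : forall x y, M <= x -> x <= y ->
  (y - x) / F y <= G y - G x <= (y - x) / F x.
Proof.
intros x y Hx Hxy.
assert (E : G y - G x = RInt (fun y => / F y) x y).
{ unfold G, Defs.G; fold F.
  rewrite <- (RInt_Chasles (fun y => / F y) M x y)
    by (apply ex_RInt_inv_F; lra).
  unfold plus; simpl; ring. }
assert (Hcst : forall k, RInt (fun _ => k) x y = (y - x) * k).
{ intros k; rewrite RInt_const; reflexivity. }
rewrite E; unfold Rdiv; rewrite <- !Hcst; split.
- apply RInt_le; [exact Hxy|apply ex_RInt_const|apply ex_RInt_inv_F; assumption|].
  intros z Hz; apply Rinv_le_contravar; [apply F_gt_0; lra|apply F_le; lra].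
- apply RInt_le; [exact Hxy|apply ex_RInt_inv_F; assumption|apply ex_RInt_const|].
  intros z Hz; apply Rinv_le_contravar; [apply F_gt_0; lra|apply F_le; lra].
Qed.

Lemma G_M : G M = 0.
Proof. apply (RInt_point M (fun y => / F y)). Qed.

Lemma G_le : forall x y, M <= x -> x <= y -> G x <= G y.
Proof.
intros x y Hx Hxy; destruct (G_increment x y Hx Hxy) as [H _].
assert (0 <= (y - x) / F y)
  by (apply Rdiv_le_0_compat; [lra|apply F_gt_0; lra]).
lra.
Qed.

Lemma G_lt : forall x y, M <= x -> x < y -> G x < G y.
Proof.
intros x y Hx Hxy; destruct (G_increment x y Hx ltac:(lra)) as [H _].
assert (0 < (y - x) / F y)
  by (apply Rdiv_lt_0_compat; [lra|apply F_gt_0; lra]).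
lra.
Qed.

Lemma G_ge_0 : forall x, M <= x -> 0 <= G x.
Proof. intros x Hx; rewrite <- G_M; apply G_le; lra. Qed.

Lemma Ginv_spec : forall x s, M <= x -> 0 <= s <= G x ->
  M <= Ginv C1 M alpha beta s <= x /\ G (Ginv C1 M alpha beta s) = s.
Proof.
intros x s Hx Hs.
assert (Hex : exists y, M <= y <= x /\ G y = s).
(* extended by [0] below [M], the function [G] is Lipschitz on the line *)
{ pose (g := fun y => G (Rmax y M)).
  assert (HF := F_gt_0 M ltac:(lra)).
  assert (Hlip : forall y z, y <= z -> 0 <= g z - g y <= (z - y) / F M).
  { intros y z Hyz; unfold g.
    assert (Hm : Rmax y M <= Rmax z M) by (apply Rle_max_compat_r, Hyz).
    split; [generalize (G_le _ _ (Rmax_r y M) Hm); lra|].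
    apply Rle_trans with (1 := proj2 (G_increment _ _ (Rmax_r y M) Hm)).
    apply Rle_trans with ((Rmax z M - Rmax y M) / F M).
    - apply Rmult_le_compat_l; [lra|]; apply Rinv_le_contravar; [exact HF|].
      apply F_le; [lra|apply Rmax_r].
    - apply Rmult_le_compat_r; [apply Rlt_le, Rinv_0_lt_compat, HF|].
      unfold Rmax; destruct (Rle_dec z M) as [h|h], (Rle_dec y M) as [h'|h'];
        try apply Rnot_le_lt in h; try apply Rnot_le_lt in h'; lra. }
  assert (Cg : Ranalysis1.continuity g).
  { intros y e He; exists (e * F M); split;
      [apply Rmult_lt_0_compat; [exact He|exact HF]|].
    intros z [_ Hz]; simpl in *; unfold Rdist in *.
    assert (Habs : Rabs (g z - g y) <= Rabs (z - y) / F M).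
    { destruct (Rle_or_lt y z) as [H|H].
      - destruct (Hlip y z H); rewrite !Rabs_pos_eq; lra.
      - destruct (Hlip z y ltac:(lra)).
        rewrite Rabs_minus_sym, (Rabs_minus_sym z), !Rabs_pos_eq; lra. }
    apply Rle_lt_trans with (1 := Habs).
    apply Rmult_lt_reg_r with (F M); [exact HF|].
    unfold Rdiv; rewrite Rmult_assoc, Rinv_l; lra. }
  destruct (IVT_gen g M x s Cg) as [y [Hy Hgy]].
  - unfold g; rewrite (Rmax_left M), (Rmax_left x) by lra; rewrite G_M.
    rewrite Rmin_left, Rmax_right by lra; lra.
  - rewrite Rmin_left, Rmax_right in Hy by lra.
    unfold g in Hgy; rewrite Rmax_left in Hgy by lra.
    exists y; auto. }
destruct Hex as [y [Hy Hgy]].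
assert (E : Ginv C1 M alpha beta s = y).
{ apply (iota_unique (K := R_AbsRing) (V := R_CompleteNormedModule)).
  - intros z [Hz Hgz']; assert (Hgz : G z = s) by exact Hgz'.
    destruct (Rtotal_order z y) as [H|[H|H]]; [|exact H|].
    + exfalso; generalize (G_lt z y Hz H); lra.
    + exfalso; generalize (G_lt y z ltac:(lra) H); lra.
  - split; [lra|exact Hgy]. }
rewrite E; auto.
Qed.

Lemma Q_spec : forall t x, M <= x -> 0 <= t <= G x ->
  M <= Q t x <= x /\ G (Q t x) = G x - t.
Proof. intros t x Hx Ht; apply Ginv_spec; [exact Hx|fold G; lra]. Qed.

Lemma Q_increment_time : forall s t x, M <= x -> 0 <= s -> s <= t -> t <= G x ->
  F (Q t x) * (t - s) <= Q s x - Q t x <= F (Q s x) * (t - s).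
Proof.
intros s t x Hx Hs Hst Ht.
destruct (Q_spec s x Hx ltac:(lra)) as [Hs1 Hs2].
destruct (Q_spec t x Hx ltac:(lra)) as [Ht1 Ht2].
assert (Hle : Q t x <= Q s x).
{ apply Rnot_lt_le; intro H.
  generalize (G_lt (Q s x) (Q t x) ltac:(lra) H); lra. }
destruct (G_increment (Q t x) (Q s x) ltac:(lra) Hle) as [H1 H2].
rewrite Hs2, Ht2 in H1, H2.
assert (F1 := F_gt_0 (Q t x) ltac:(lra)).
assert (F2 := F_gt_0 (Q s x) ltac:(lra)).
apply (Rmult_le_compat_r (F (Q s x))) in H1; [|lra].
apply (Rmult_le_compat_r (F (Q t x))) in H2; [|lra].
unfold Rdiv in H1, H2; rewrite Rmult_assoc, Rinv_l in H1, H2 by lra.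
lra.
Qed.

Lemma Q_displacement : forall t x, M <= x -> 0 <= t <= G x -> x - Q t x <= t * F x.
Proof.
intros t x Hx Ht.
destruct (Q_increment_time 0 t x) as [_ H]; try lra.
destruct (Q_spec 0 x Hx ltac:(lra)) as [[H1 H2] H3].
assert (E : Q 0 x = x).
{ apply Rle_antisym; [exact H2|]; apply Rnot_lt_le; intro Hlt.
  generalize (G_lt (Q 0 x) x H1 Hlt); lra. }
rewrite E in H; lra.
Qed.

Lemma Q_increment_space : forall t x y, M <= x -> x <= y -> 0 <= t <= G x ->
  (y - x) * F (Q t x) / F y <= Q t y - Q t x <= (y - x) * F (Q t y) / F x.
Proof.
intros t x y Hx Hxy Ht.
assert (Hy : M <= y) by lra.
assert (HG := G_le x y Hx Hxy).
destruct (Q_spec t x Hx Ht) as [Hx1 Hx2].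
destruct (Q_spec t y Hy ltac:(lra)) as [Hy1 Hy2].
assert (Hle : Q t x <= Q t y).
{ apply Rnot_lt_le; intro H.
  generalize (G_lt (Q t y) (Q t x) ltac:(lra) H); lra. }
destruct (G_increment (Q t x) (Q t y) ltac:(lra) Hle) as [H1 H2].
destruct (G_increment _ _ Hx Hxy) as [H3 H4].
rewrite Hx2, Hy2 in H1, H2.
assert (F1 := F_gt_0 (Q t x) ltac:(lra)).
assert (F2 := F_gt_0 (Q t y) ltac:(lra)).
assert (A1 : (y - x) / F y <= (Q t y - Q t x) / F (Q t x)) by lra.
assert (A2 : (Q t y - Q t x) / F (Q t y) <= (y - x) / F x) by lra.
apply (Rmult_le_compat_r (F (Q t x))) in A1; [|lra].
apply (Rmult_le_compat_r (F (Q t y))) in A2; [|lra].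
unfold Rdiv in *; rewrite (Rmult_assoc (Q t y - Q t x)), Rinv_l in A1, A2 by lra.
lra.
Qed.

(** [dQ/dt = - F(Q)], one-sided at both ends of the time interval. *)
Lemma is_derive_on_Q : forall T x t, M <= x -> T <= G x -> segment 0 T t ->
  is_derive_on (segment 0 T) (fun s => Q s x) t (- F (Q t x)).
Proof.
intros T x t Hx HT Ht; unfold segment in Ht.
destruct (Q_spec t x Hx ltac:(lra)) as [Hq _].
assert (HFx := F_gt_0 x Hx).
assert (Hslope : forall s, segment 0 T s ->
          Rabs (Q s x - Q t x) <= F x * Rabs (s - t) /\
          Rabs (Q s x - Q t x + F (Q t x) * (s - t))
          <= Rabs (F (Q s x) - F (Q t x)) * Rabs (s - t)).
{ intros s Hs; unfold segment in Hs.
  destruct (Q_spec s x Hx ltac:(lra)) as [Hqs _].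
  assert (G1 := F_le (Q s x) x ltac:(lra) ltac:(lra)).
  assert (G2 := F_le (Q t x) x ltac:(lra) ltac:(lra)).
  assert (F1 := F_gt_0 (Q t x) ltac:(lra)).
  assert (F2 := F_gt_0 (Q s x) ltac:(lra)).
  destruct (Rle_or_lt s t) as [Hst|Hst].
  - destruct (Q_increment_time s t x) as [H1 H2]; try lra.
    assert (0 <= F (Q t x) * (t - s)) by (apply Rmult_le_pos; lra).
    assert (F (Q s x) * (t - s) <= F x * (t - s))
      by (apply Rmult_le_compat_r; lra).
    assert (E : Rabs (s - t) = t - s) by (rewrite Rabs_left1; lra).
    rewrite E; split; [rewrite Rabs_pos_eq; lra|].
    apply Rle_trans with ((F (Q s x) - F (Q t x)) * (t - s)).
    + rewrite Rabs_pos_eq; lra.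
    + apply Rmult_le_compat_r; [lra|apply Rle_abs].
  - destruct (Q_increment_time t s x) as [H1 H2]; try lra.
    assert (0 <= F (Q s x) * (s - t)) by (apply Rmult_le_pos; lra).
    assert (F (Q t x) * (s - t) <= F x * (s - t))
      by (apply Rmult_le_compat_r; lra).
    rewrite (Rabs_pos_eq (s - t)) by lra; split; [rewrite Rabs_left1; lra|].
    apply Rle_trans with ((F (Q t x) - F (Q s x)) * (s - t)).
    + rewrite Rabs_pos_eq; lra.
    + apply Rmult_le_compat_r; [lra|].
      rewrite Rabs_minus_sym; apply Rle_abs. }
apply is_derive_on_slope; [exact Ht|].
exists (fun s => if Req_EM_T s t then - F (Q t x)
                 else (Q s x - Q t x) / (s - t)); split.
- apply filterlim_within_eps; intros eps Heps.
  assert (HM := M_pos _ _ _ _ _ hr).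
  destruct (F_continuous (Q t x) ltac:(lra) (fun z => Rabs (z - F (Q t x)) < eps))
    as [d Hd].
  { exists (mkposreal _ Heps); intros z Hz; exact Hz. }
  exists (d / F x); split; [apply Rdiv_lt_0_compat; [apply cond_pos|exact HFx]|].
  intros s Hs Hst; destruct (Hslope s Hs) as [A1 A2].
  destruct (Req_EM_T s t) as [_|Hne].
  + rewrite Rminus_diag, Rabs_R0; exact Heps.
  + assert (Hp : 0 < Rabs (s - t)) by (apply Rabs_pos_lt; lra).
    apply Rmult_lt_reg_r with (Rabs (s - t)); [exact Hp|].
    rewrite <- Rabs_mult.
    replace (((Q s x - Q t x) / (s - t) - - F (Q t x)) * (s - t))
      with (Q s x - Q t x + F (Q t x) * (s - t)) by (field; lra).
    apply Rle_lt_trans with (1 := A2), Rmult_lt_compat_r; [exact Hp|].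
    apply (Hd (Q s x)).
    change (Rabs (Q s x - Q t x) < d).
    apply Rle_lt_trans with (1 := A1).
    apply Rlt_le_trans with (2 := Req_le (F x * (d / F x)) d ltac:(field; lra)).
    apply Rmult_lt_compat_l; assumption.
- intros s _; destruct (Req_EM_T s t) as [->|Hne]; [ring|field; lra].
Qed.

End Characteristics.

(** * Smoothness along characteristics *)

Lemma half_line_derivatives_F : forall (C1 : R) (alpha beta : R -> R)
    (da db : nat -> R -> R),
  half_line_derivatives alpha da -> half_line_derivatives beta db ->
  half_line_derivatives (F C1 alpha beta) (fun k x => db k x * C1 + (-1) * da k x).
Proof.
intros C1 alpha beta da db [A0 A1] [B0 B1]; split.
- intros x Hx; rewrite A0, B0 by exact Hx; unfold F; ring.
- intros k x Hx.
  assert (Hcst : forall l : R, is_derive_on Rplus_set (fun _ => l) x 0).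
  { intros l; apply is_derive_on_of_is_derive; [exact Hx|].
    apply (is_derive_const l x). }
  assert (P1 := is_derive_on_mult _ _ _ _ _ _ Hx (B1 k x Hx) (Hcst C1)).
  assert (P2 := is_derive_on_mult _ _ _ _ _ _ Hx (Hcst (-1)) (A1 k x Hx)).
  assert (P3 := is_derive_on_plus _ _ _ _ _ _ Hx P1 P2).
  replace (db (S k) x * C1 + -1 * da (S k) x)
    with (db (S k) x * C1 + db k x * 0 + (0 * da k x + -1 * da (S k) x)) by ring.
  exact P3.
Qed.

(** Polynomial expressions in the partial derivatives of the solution and the
    derivatives of the drift, read along a characteristic.  Differentiation in
    time stays inside this class, which yields derivatives of all orders. *)
Inductive curve_expr : Set :=
| Esol (i j : nat)
| Edrift (k : nat)
| Eopp (e : curve_expr)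
| Eadd (e1 e2 : curve_expr)
| Emul (e1 e2 : curve_expr).

Fixpoint curve_eval (d : nat -> nat -> R -> R -> R) (fd : nat -> R -> R)
    (q : R -> R) (e : curve_expr) (t : R) : R :=
  match e with
  | Esol i j => d i j t (q t)
  | Edrift k => fd k (q t)
  | Eopp e => (-1) * curve_eval d fd q e t
  | Eadd e1 e2 => curve_eval d fd q e1 t + curve_eval d fd q e2 t
  | Emul e1 e2 => curve_eval d fd q e1 t * curve_eval d fd q e2 t
  end.

(** Formal time derivative when [q' = - F(q)]. *)
Fixpoint curve_diff (e : curve_expr) : curve_expr :=
  match e with
  | Esol i j => Eadd (Esol (S i) j) (Emul (Esol i (S j)) (Eopp (Edrift 0)))
  | Edrift k => Emul (Edrift (S k)) (Eopp (Edrift 0))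
  | Eopp e => Eopp (curve_diff e)
  | Eadd e1 e2 => Eadd (curve_diff e1) (curve_diff e2)
  | Emul e1 e2 => Eadd (Emul (curve_diff e1) e2) (Emul e1 (curve_diff e2))
  end.

Lemma curve_eval_derive : forall (E : R -> Prop) (c : R -> R -> R)
    (d : nat -> nat -> R -> R -> R) (f : R -> R) (fd : nat -> R -> R) (q : R -> R),
  partials c d -> half_line_derivatives f fd ->
  (forall t, E t -> 0 <= t) -> (forall t, E t -> 0 <= q t) ->
  (forall t, E t -> is_derive_on E q t (- f (q t))) ->
  forall e t, E t ->
    is_derive_on E (curve_eval d fd q e) t (curve_eval d fd q (curve_diff e) t).
Proof.
intros E c d f fd q Hd Hf HE Hq Dq e.
assert (Dq' : forall t, E t -> is_derive_on E q t (-1 * fd 0%nat (q t))).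
{ intros t Ht; rewrite (proj1 Hf) by auto.
  replace (-1 * f (q t)) with (- f (q t)) by ring; auto. }
induction e as [i j|k|e IH|e1 IH1 e2 IH2|e1 IH1 e2 IH2]; intros t Ht; simpl.
- apply (is_derive_on_curve E (d i j) (d (S i) j) (d i (S j) t) q); auto.
  + intros s x Hs; apply (proj2 Hd i j); exact Hs.
  + apply (proj2 Hd (S i) j).
  + apply (proj2 Hd i j); auto.
- apply (is_derive_on_comp E Rplus_set); auto.
  apply (proj2 Hf k (q t)); auto.
- assert (P : is_derive_on E (fun _ => -1) t 0).
  { apply is_derive_on_of_is_derive; [exact Ht|apply (is_derive_const (-1) t)]. }
  assert (H := is_derive_on_mult _ _ _ _ _ _ Ht P (IH t Ht)).
  replace (-1 * curve_eval d fd q (curve_diff e) t)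
    with (0 * curve_eval d fd q e t + -1 * curve_eval d fd q (curve_diff e) t)
    by ring.
  exact H.
- apply (is_derive_on_plus E); auto.
- apply (is_derive_on_mult E); auto.
Qed.

Section Along_characteristics.

Variables (C1 gamma M : R) (alpha beta : R -> R).
Hypothesis hr : rates_assumption C1 gamma M alpha beta.
Variables (c : R -> R -> R) (d : nat -> nat -> R -> R -> R).
Hypothesis hd : partials c d.
Variables (T x : R).
Hypothesis hx : M <= x.
Hypothesis hT : T <= G C1 M alpha beta x.

Let q t := Q C1 M alpha beta t x.

(** Derivatives of all orders of [t |-> c (t, Q (t, x))]; the first one is the
    transport derivative of the solution. *)
Lemma characteristic_derivatives : exists e : nat -> R -> R,
  (forall t, segment 0 T t -> e 0%nat t = c t (q t)) /\
  (forall t, segment 0 T t ->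
     e 1%nat t = d 1%nat 0%nat t (q t) - F C1 alpha beta (q t) * d 0%nat 1%nat t (q t)) /\
  (forall k t, segment 0 T t -> is_derive_on (segment 0 T) (e k) t (e (S k) t)).
Proof.
destruct (rate_derivatives _ _ (alpha_rate _ _ _ _ _ hr)) as [da Ha].
destruct (rate_derivatives _ _ (beta_rate _ _ _ _ _ hr)) as [db Hb].
assert (Hf := half_line_derivatives_F C1 alpha beta da db Ha Hb).
pose (fd := fun k x => db k x * C1 + (-1) * da k x); fold fd in Hf.
assert (HM := M_pos _ _ _ _ _ hr).
assert (Hq : forall t, segment 0 T t -> 0 <= q t).
{ intros t [Ht1 Ht2].
  destruct (Q_spec _ _ _ _ _ hr t x hx) as [Hq _]; [lra|].
  unfold q; lra. }
exists (fun k => curve_eval d fd q (Nat.iter k curve_diff (Esol 0 0))).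
split; [|split].
- intros t Ht; apply (proj1 hd), Ht.
- intros t Ht; simpl; rewrite (proj1 Hf) by auto; ring.
- intros k t Ht; change (Nat.iter (S k) curve_diff (Esol 0 0))
    with (curve_diff (Nat.iter k curve_diff (Esol 0 0))).
  apply (curve_eval_derive (segment 0 T) c d (F C1 alpha beta)); auto.
  + intros s Hs; apply Hs.
  + intros s Hs; apply (is_derive_on_Q _ _ _ _ _ hr T x s); auto.
Qed.

End Along_characteristics.

(** * The remainder for large indices *)

(** The growth assumptions of orders [0] and [1], read on the window
    [[z/2, 2z]]. *)
Lemma rate_local_bounds : forall gamma a, 0 <= gamma <= 1 / 2 -> rate gamma a ->
  exists A X, 0 <= A /\ 4 <= X /\
  forall z, X <= z ->
    (forall x, z / 2 <= x <= 2 * z -> Rabs (a x) <= A * Rpower z gamma) /\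
    (forall x y, z / 2 <= x <= 2 * z -> z / 2 <= y <= 2 * z ->
       Rabs (a x - a y) <= A * (Rpower z gamma / z) * Rabs (x - y)).
Proof.
intros gamma a Hg Ha.
destruct (rate_derivatives _ _ Ha) as [d Hd].
destruct (rate_growth _ _ Ha 0%nat ltac:(lia)) as [A0 [X0 H0]].
destruct (rate_growth _ _ Ha 1%nat ltac:(lia)) as [A1 [X1 H1]].
assert (P0 := Rabs_pos A0); assert (P1 := Rabs_pos A1).
exists (2 * Rabs A0 + 4 * Rabs A1), (4 + 2 * Rabs X0 + 2 * Rabs X1).
assert (Q0 := Rabs_pos X0); assert (Q1 := Rabs_pos X1).
assert (L0 := Rle_abs X0); assert (L1 := Rle_abs X1).
split; [lra|]; split; [lra|]; intros z Hz.
assert (Hp : 0 < Rpower z gamma) by apply exp_pos.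
assert (Hpz : 0 < Rpower z gamma / z) by (apply Rdiv_lt_0_compat; lra).
split.
- intros x Hx; destruct (Rpower_comparable z x gamma) as [_ Hc]; try lra.
  specialize (H0 x ltac:(lra)); simpl in H0; rewrite Rminus_0_r in H0.
  assert (Hpx : 0 < Rpower x gamma) by apply exp_pos.
  apply Rle_trans with (1 := H0).
  apply Rle_trans with (Rabs A0 * (2 * Rpower z gamma)).
  + apply Rle_trans with (Rabs A0 * Rpower x gamma).
    * apply Rmult_le_compat_r; [lra|apply Rle_abs].
    * apply Rmult_le_compat_l; lra.
  + assert (0 <= Rabs A1 * Rpower z gamma) by (apply Rmult_le_pos; lra).
    lra.
- assert (Hder : forall x, z / 2 <= x <= 2 * z ->
            Rabs (Derive a x) <= 4 * Rabs A1 * (Rpower z gamma / z)).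
  { intros x Hx; destruct (Rpower_comparable z x gamma) as [_ Hc]; try lra.
    specialize (H1 x ltac:(lra)); simpl in H1.
    assert (E : Rpower x (gamma - 1) = Rpower x gamma / x).
    { unfold Rminus; rewrite Rpower_plus, Rpower_Ropp, Rpower_1 by lra.
      reflexivity. }
    rewrite E in H1.
    apply Rle_trans with (1 := H1).
    assert (Hpx : 0 < Rpower x gamma) by apply exp_pos.
    assert (Hi : / x <= 2 / z).
    { apply Rmult_le_reg_r with (x * z); [apply Rmult_lt_0_compat; lra|].
      field_simplify; lra. }
    assert (Hix : 0 < / x) by (apply Rinv_0_lt_compat; lra).
    apply Rle_trans with (Rabs A1 * (Rpower x gamma / x)).
    - apply Rmult_le_compat_r; [|apply Rle_abs].
      apply Rlt_le, Rmult_lt_0_compat; assumption.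
    - replace (4 * Rabs A1 * (Rpower z gamma / z))
        with (Rabs A1 * (2 * Rpower z gamma * (2 / z))) by (field; lra).
      apply Rmult_le_compat_l; [lra|].
      apply Rmult_le_compat; lra. }
  intros x y Hx Hy.
  destruct (MVT_gen a y x (Derive a)) as [xi [Hxi Heq]].
  + intros u Hu.
    assert (Hu0 : 0 < u)
      by (revert Hu; unfold Rmin, Rmax; destruct (Rle_dec y x); lra).
    apply Derive_correct; exists (d 1%nat u); apply half_line_is_derive; assumption.
  + intros u Hu.
    assert (Hu0 : 0 < u)
      by (revert Hu; unfold Rmin, Rmax; destruct (Rle_dec y x); lra).
    apply derivable_continuous_pt; exists (d 1%nat u).
    apply is_derive_Reals, half_line_is_derive; assumption.
  + rewrite Heq, Rabs_mult; apply Rmult_le_compat_r; [apply Rabs_pos|].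
    assert (Hxi' : z / 2 <= xi <= 2 * z)
      by (revert Hxi; unfold Rmin, Rmax; destruct (Rle_dec y x); lra).
    apply Rle_trans with (1 := Hder xi Hxi'), Rmult_le_compat_r; lra.
Qed.

(** Second-order Taylor formula around [x]; the increment may have any sign. *)
Lemma Taylor_second_order : forall (e : nat -> R -> R) (x h B : R),
  (forall k u, is_derive (e k) u (e (S k) u)) ->
  (forall u, Rmin x (x + h) <= u <= Rmax x (x + h) -> Rabs (e 3%nat u) <= B) ->
  exists rem, e 0%nat (x + h) = e 0%nat x + e 1%nat x * h + e 2%nat x * h ^ 2 / 2 + rem
    /\ Rabs rem <= B * Rabs h ^ 3.
Proof.
intros e x h B He HB.
pose (g := fun k u => h ^ k * e k (x + u * h)).
assert (Hg : forall k u, is_derive (g k) u (g (S k) u)).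
{ intros k u; unfold g.
  replace (h ^ S k * e (S k) (x + u * h)) with (h ^ k * (h * e (S k) (x + u * h)))
    by (simpl; ring).
  apply is_derive_scal, (is_derive_comp (e k) (fun u => x + u * h)); [apply He|].
  auto_derive; auto; ring. }
assert (Hn := Derive_n_family (g 0%nat) g (fun _ => eq_refl) Hg).
destruct (Taylor_Lagrange (g 0%nat) 2 0 1 Rlt_0_1) as [z [Hz Heq]].
{ intros u _ k _; destruct k as [|k]; [exact I|].
  exists (g (S k) u); apply is_derive_ext with (g k); [|apply Hg].
  intros v; symmetry; apply Hn. }
cbn [sum_f_R0] in Heq; rewrite !Hn in Heq.
exists ((1 - 0) ^ 3 / INR (Factorial.fact 3) * g 3%nat z).
unfold g in *; simpl in Heq |- *.
split.
- replace (x + h) with (x + 1 * h) by ring.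
  replace (x + 0 * h) with x in Heq by ring.
  revert Heq; generalize (e 3%nat (x + z * h)).
  intros e3 Heq; rewrite Rmult_1_l in Heq at 1; rewrite Heq.
  field.
- assert (H3 : Rabs (e 3%nat (x + z * h)) <= B).
  { apply HB; unfold Rmin, Rmax.
    destruct (Rle_dec x (x + h)) as [Hh|Hh]; [nra|].
    apply Rnot_le_lt in Hh; nra. }
  replace ((1 - 0) * ((1 - 0) * ((1 - 0) * 1))
      / (1 + 1 + 1 + 1 + 1 + 1) * (h * (h * (h * 1)) * e 3%nat (x + z * h)))
    with (/ 6 * (e 3%nat (x + z * h) * h ^ 3)) by field.
  rewrite !Rabs_mult, <- RPow_abs, (Rabs_pos_eq (/ 6)) by lra.
  assert (Hh : 0 <= Rabs h ^ 3) by (apply pow_le, Rabs_pos).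
  assert (Rabs (e 3%nat (x + z * h)) * Rabs h ^ 3 <= B * Rabs h ^ 3)
    by (apply Rmult_le_compat_r; assumption).
  assert (0 <= Rabs (e 3%nat (x + z * h)) * Rabs h ^ 3)
    by (apply Rmult_le_pos; [apply Rabs_pos|exact Hh]).
  replace (Rabs h * (Rabs h * (Rabs h * 1))) with (Rabs h ^ 3) by ring.
  lra.
Qed.

(** Bookkeeping of the orders in [s = n^(gamma/2)]: [u, u1, u2] stand for the
    solution and its first two derivatives at [Q_n], [um, up] for its values at
    [Q_(n-1), Q_(n+1)], [b] and [a] for the rates [beta C1] and [alpha] at [n - 1],
    [n], [n + 1] (suffixes [m], [n], [p]) and at [Q_n] (suffix [q]), [hm, hp] for
    the increments of [Q] and [em, ep] for the Taylor remainders.  What is not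
    [O(1/s)] cancels. *)
Lemma remainder_algebra :
  forall K s u u1 u2 um up em ep hm hp bm bn bq ap an aq : R,
  0 <= K -> 1 <= s ->
  Rabs u <= K -> s * Rabs u1 <= K -> s ^ 2 * Rabs u2 <= K ->
  s ^ 3 * Rabs em <= K -> s ^ 3 * Rabs ep <= K ->
  um = u + u1 * hm + u2 * hm ^ 2 / 2 + em ->
  up = u + u1 * hp + u2 * hp ^ 2 / 2 + ep ->
  Rabs bm <= K * s ^ 2 -> Rabs ap <= K * s ^ 2 ->
  Rabs (bm - bq) <= K -> Rabs (ap - aq) <= K ->
  s * Rabs (bm - bn) <= K -> s * Rabs (ap - an) <= K ->
  s ^ 2 * Rabs (hm + 1) <= K -> s ^ 2 * Rabs (hp - 1) <= K ->
  s * Rabs (1 / 2 * (bq + aq) * u2 - (bq - aq) * u1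
            - (bm * um - (bn + an) * u + ap * up))
  <= 8 * K ^ 2 + 4 * K ^ 3 + K ^ 4.
Proof.
intros K s u u1 u2 um up em ep hm hp bm bn bq ap an aq HK Hs Hu Hu1 Hu2 Hem Hep
  -> -> Hbm Hap Hbq Haq Hbn Han Hhm Hhp.
assert (Hs2 : 1 <= s ^ 2) by nra.
assert (Hscale : forall k x, 0 <= k -> Rabs (k * x) = k * Rabs x).
{ intros k x Hk; rewrite Rabs_mult, (Rabs_pos_eq k Hk); reflexivity. }
assert (Hs3 : 0 <= s ^ 3) by (apply pow_le; lra).
(* a product of a rate with an increment correction is bounded *)
assert (Hprod : forall b e, Rabs b <= K * s ^ 2 -> s ^ 2 * Rabs e <= K ->
          Rabs (b * e) <= K * K).
{ intros b e Hb He; rewrite Rabs_mult.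
  apply Rle_trans with (K * s ^ 2 * Rabs e).
  - apply Rmult_le_compat_r; [apply Rabs_pos|exact Hb].
  - rewrite Rmult_assoc; apply Rmult_le_compat_l; assumption. }
assert (Hprod3 : forall b e, Rabs b <= K * s ^ 2 -> s ^ 3 * Rabs e <= K ->
          Rabs (s * (b * e)) <= K * K).
{ intros b e Hb He; rewrite Hscale, Rabs_mult by lra.
  apply Rle_trans with (s * (K * s ^ 2 * Rabs e)).
  - apply Rmult_le_compat_l; [lra|].
    apply Rmult_le_compat_r; [apply Rabs_pos|exact Hb].
  - replace (s * (K * s ^ 2 * Rabs e)) with (K * (s ^ 3 * Rabs e)) by ring.
    apply Rmult_le_compat_l; assumption. }
assert (Hsmall : forall e, s ^ 2 * Rabs e <= K -> Rabs e <= K).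
{ intros e He; assert (H := Rabs_pos e); nra. }
assert (Hsu2 : s * Rabs u2 <= K).
{ assert (H := Rabs_pos u2).
  assert (s * Rabs u2 <= s ^ 2 * Rabs u2) by (apply Rmult_le_compat_r; nra).
  lra. }
assert (T1 : Rabs (s * (bm - bn) * u) <= K * K).
{ apply Rabs_mult_le; [rewrite Hscale by lra|]; assumption. }
assert (T2 : Rabs (s * (ap - an) * u) <= K * K).
{ apply Rabs_mult_le; [rewrite Hscale by lra|]; assumption. }
assert (T3 : Rabs (s * u1 * ((bm - bq) - bm * (hm + 1) + (- (ap - aq) - ap * (hp - 1))))
             <= K * (2 * (K + K * K))).
{ apply Rabs_mult_le; [rewrite Hscale by lra; exact Hu1|].
  replace (2 * (K + K * K)) with (K + K * K + (K + K * K)) by ring.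
  apply Rabs_plus_le; apply Rabs_plus_le; rewrite ?Rabs_Ropp; auto. }
assert (T4 : Rabs (s * u2 * (1 / 2 * ((- (bm - bq) + bm * (hm + 1) * (2 - (hm + 1)))
                     + (- (ap - aq) + - (ap * (hp - 1)) * (2 + (hp - 1))))))
             <= K * (1 / 2 * (K + K * K * (2 + K) + (K + K * K * (2 + K))))).
{ apply Rabs_mult_le; [rewrite Hscale by lra; exact Hsu2|].
  rewrite Hscale by lra; apply Rmult_le_compat_l; [lra|].
  apply Rabs_plus_le; apply Rabs_plus_le; rewrite ?Rabs_Ropp; auto;
    (apply Rabs_mult_le; [rewrite ?Rabs_Ropp; auto|]);
    (apply Rabs_plus_le; [rewrite Rabs_pos_eq; lra|rewrite ?Rabs_Ropp; auto]). }
assert (T5 := Hprod3 bm em Hbm Hem).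
assert (T6 := Hprod3 ap ep Hap Hep).
rewrite <- Hscale by lra.
match goal with |- Rabs ?e <= _ => replace e with
  (- (s * (bm - bn) * u) + - (s * (ap - an) * u)
   + (s * u1 * ((bm - bq) - bm * (hm + 1) + (- (ap - aq) - ap * (hp - 1)))
      + s * u2 * (1 / 2 * ((- (bm - bq) + bm * (hm + 1) * (2 - (hm + 1)))
                     + (- (ap - aq) + - (ap * (hp - 1)) * (2 + (hp - 1))))))
   + (- (s * (bm * em)) + - (s * (ap * ep)))) by field end.
replace (8 * K ^ 2 + 4 * K ^ 3 + K ^ 4)
  with (K * K + K * K
        + (K * (2 * (K + K * K))
           + K * (1 / 2 * (K + K * K * (2 + K) + (K + K * K * (2 + K)))))
        + (K * K + K * K) + (K ^ 2)) by field.
apply Rle_trans with (2 := Rplus_le_compat_l _ _ _ (pow2_ge_0 K)).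
rewrite Rplus_0_r.
apply Rabs_plus_le; [apply Rabs_plus_le; [apply Rabs_plus_le|apply Rabs_plus_le]|
  apply Rabs_plus_le]; rewrite ?Rabs_Ropp; assumption.
Qed.

Lemma ratio_near_1 : forall x a b a' b' m K : R,
  0 < m -> m <= b -> m <= b' -> Rabs (a - b) <= K -> Rabs (a' - b') <= K ->
  a / b <= x <= a' / b' -> m * Rabs (x - 1) <= K.
Proof.
intros x a b a' b' m K Hm Hb Hb' Ha Ha' [H1 H2].
apply Rabs_le_between in Ha; apply Rabs_le_between in Ha'.
assert (HK : 0 <= K) by lra.
apply (Rmult_le_compat_r b) in H1; [|lra].
apply (Rmult_le_compat_r b') in H2; [|lra].
unfold Rdiv in H1, H2; rewrite Rmult_assoc, Rinv_l in H1, H2 by lra.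
destruct (Rle_or_lt 1 x) as [Hx|Hx].
- rewrite Rabs_pos_eq by lra.
  assert (m * (x - 1) <= b' * (x - 1)) by (apply Rmult_le_compat_r; lra).
  lra.
- rewrite Rabs_left by lra.
  assert (m * - (x - 1) <= b * - (x - 1)) by (apply Rmult_le_compat_r; lra).
  lra.
Qed.

(** The remainder, multiplied by [z^(gamma/2)], is bounded for large [z]: the
    characteristics starting from [z - 1], [z], [z + 1] stay at a distance
    [O(z^gamma)] of [z], over which the rates vary by [O(1)] only since
    [2 gamma <= 1]. *)
Lemma large_index_remainder :
  forall (C1 gamma M x0 : R) (alpha beta sigma sigma0 sigmab c0 : R -> R)
    (c : R -> R -> R) (d : nat -> nat -> R -> R -> R),
  0 <= C1 -> rates_assumption C1 gamma M alpha beta ->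
  diffusion_assumption C1 gamma M alpha beta sigma sigma0 sigmab ->
  initial_assumption sigma0 c0 ->
  bounded_smooth_solution sigma c0 c -> partials c d ->
  M <= x0 ->
  exists K N, forall z t, N <= z -> x0 + 1 <= z ->
    0 <= t <= G C1 M alpha beta x0 ->
    let q := Q C1 M alpha beta t in
    Rpower z (gamma / 2) *
    Rabs (d 1%nat 0%nat t (q z) - F C1 alpha beta (q z) * d 0%nat 1%nat t (q z)
          - (beta (z - 1) * C1 * d 0%nat 0%nat t (q (z - 1))
             - (beta z * C1 + alpha z) * d 0%nat 0%nat t (q z)
             + alpha (z + 1) * d 0%nat 0%nat t (q (z + 1)))) <= K.
Proof.
intros C1 gamma M x0 alpha beta sigma sigma0 sigmab c0 c d HC1 hr hs hi hc hd Hx0.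
assert (Hg := gamma_range _ _ _ _ _ hr).
pose (T := G C1 M alpha beta x0); fold T.
assert (HT : 0 <= T) by (apply (G_ge_0 _ _ _ _ _ hr); exact Hx0).
destruct (solution_derivative_decay C1 gamma M T alpha beta sigma sigma0 sigmab
            c0 c d Hg HT hs hi hc hd) as [K [HK Hdec]].
destruct (rate_local_bounds gamma alpha Hg (alpha_rate _ _ _ _ _ hr))
  as [Aa [Xa [HAa [HXa Ba]]]].
destruct (rate_local_bounds gamma beta Hg (beta_rate _ _ _ _ _ hr))
  as [Ab [Xb [HAb [HXb Bb]]]].
destruct (F_growth _ _ _ _ _ hr) as [km [kp [Hkm [Hkp Fg]]]].
pose (L := Aa + Ab * C1).
assert (HAbC : 0 <= Ab * C1) by (apply Rmult_le_pos; assumption).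
assert (HL : 0 <= L) by (unfold L; lra).
pose (W0 := 2 * (T * kp)).
assert (HW0 : 0 <= W0).
{ assert (0 <= T * kp) by (apply Rmult_le_pos; lra); unfold W0; lra. }
pose (K1 := L * (2 + W0)).
assert (HK1 : 0 <= K1) by (apply Rmult_le_pos; lra).
pose (K2 := 2 * K1 / km).
assert (HK2 : 0 <= K2) by (apply Rdiv_le_0_compat; lra).
pose (H3 := 8 * K * (1 + K2) ^ 3).
assert (HH3 : 0 <= H3).
{ apply Rmult_le_pos; [lra|apply pow_le; lra]. }
pose (Kf := 8 * K + H3 + L + K1 + K2).
(* [(4 * W0)^2 <= z] and [s^4 <= z] give [W0 s^2 <= z / 4] *)
exists (8 * Kf ^ 2 + 4 * Kf ^ 3 + Kf ^ 4), (8 + Xa + Xb + (4 * W0) ^ 2).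
intros z t Hz Hzx Ht q.
assert (HW02 := pow2_ge_0 (4 * W0)).
specialize (Ba z ltac:(lra)); specialize (Bb z ltac:(lra)).
destruct Ba as [Ba0 Ba1]; destruct Bb as [Bb0 Bb1].
pose (s := Rpower z (gamma / 2)); fold s.
assert (Hs1 : 1 <= s) by (apply Rpower_ge_1; lra).
assert (Hss : s ^ 2 = Rpower z gamma).
{ replace (s ^ 2) with (s * s) by ring; unfold s.
  rewrite <- Rpower_plus; f_equal; field. }
assert (Hs4 : s ^ 2 * s ^ 2 <= z).
{ rewrite Hss, <- Rpower_plus.
  apply Rle_trans with (Rpower z 1); [apply Rle_Rpower; lra|].
  rewrite Rpower_1; lra. }
rewrite <- Hss in Ba0, Ba1, Bb0, Bb1.
assert (Hs2 : 1 <= s ^ 2) by nra.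
assert (Hsz : s ^ 2 / z * s ^ 2 <= 1).
{ apply Rmult_le_reg_r with z; [lra|].
  replace (s ^ 2 / z * s ^ 2 * z) with (s ^ 2 * s ^ 2) by (field; lra); lra. }
assert (Hsz0 : 0 < s ^ 2 / z) by (apply Rdiv_lt_0_compat; lra).
assert (HWz : W0 * s ^ 2 <= z / 4).
{ assert (0 <= (4 * W0 - s ^ 2) ^ 2) by apply pow2_ge_0; nra. }
(* contains [z - 1], [z], [z + 1] and the characteristics starting there *)
pose (In_w := fun x => z - 1 - W0 * s ^ 2 <= x <= z + 1).
assert (Hwin : forall x, In_w x -> z / 2 <= x <= 2 * z).
{ intros x [G1 G2]; lra. }
assert (Hdist : forall x y, In_w x -> In_w y -> Rabs (x - y) <= (2 + W0) * s ^ 2).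
{ intros x y [G1 G2] [G3 G4]; apply Rabs_le; split; lra. }
assert (La : forall x y, In_w x -> In_w y ->
          Rabs (alpha x - alpha y) <= Aa * (s ^ 2 / z) * Rabs (x - y)).
{ intros x y Hx Hy; apply Ba1; apply Hwin; assumption. }
assert (Lb : forall x y, In_w x -> In_w y ->
   Rabs (beta x * C1 - beta y * C1) <= Ab * C1 * (s ^ 2 / z) * Rabs (x - y)).
{ intros x y Hx Hy.
  replace (beta x * C1 - beta y * C1) with (C1 * (beta x - beta y)) by ring.
  rewrite Rabs_mult, (Rabs_pos_eq C1) by exact HC1.
  replace (Ab * C1 * (s ^ 2 / z) * Rabs (x - y))
    with (C1 * (Ab * (s ^ 2 / z) * Rabs (x - y))) by ring.
  apply Rmult_le_compat_l; [exact HC1|]; apply Bb1; apply Hwin; assumption. }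
assert (Hwide : forall k x y, 0 <= k <= L -> In_w x -> In_w y ->
          k * (s ^ 2 / z) * Rabs (x - y) <= K1).
{ intros k x y Hk Hx Hy.
  apply Rle_trans with (L * (s ^ 2 / z) * ((2 + W0) * s ^ 2)).
  - apply Rmult_le_compat; [|apply Rabs_pos| |apply Hdist; assumption].
    + apply Rmult_le_pos; lra.
    + apply Rmult_le_compat_r; lra.
  - replace (L * (s ^ 2 / z) * ((2 + W0) * s ^ 2))
      with (K1 * (s ^ 2 / z * s ^ 2)) by (unfold K1; ring).
    rewrite <- (Rmult_1_r K1) at 2; apply Rmult_le_compat_l; assumption. }
assert (Hstep : forall k x y, 0 <= k <= L -> Rabs (x - y) <= 1 ->
          s * (k * (s ^ 2 / z) * Rabs (x - y)) <= L).
{ intros k x y Hk Hxy.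
  apply Rle_trans with (s ^ 2 * (L * (s ^ 2 / z) * 1)).
  - apply Rmult_le_compat; [lra| |nra|].
    + apply Rmult_le_pos; [apply Rmult_le_pos; lra|apply Rabs_pos].
    + apply Rmult_le_compat; [|apply Rabs_pos| |exact Hxy].
      * apply Rmult_le_pos; lra.
      * apply Rmult_le_compat_r; lra.
  - replace (s ^ 2 * (L * (s ^ 2 / z) * 1)) with (L * (s ^ 2 / z * s ^ 2)) by ring.
    rewrite <- (Rmult_1_r L) at 2; apply Rmult_le_compat_l; assumption. }
assert (HkA : 0 <= Aa <= L) by (unfold L; lra).
assert (HkB : 0 <= Ab * C1 <= L) by (unfold L; lra).
assert (LF : forall x y, In_w x -> In_w y ->
          Rabs (F C1 alpha beta x - F C1 alpha beta y) <= K1).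
{ intros x y Hx Hy; apply Rle_trans with (L * (s ^ 2 / z) * Rabs (x - y)).
  - unfold F.
    replace (beta x * C1 - alpha x - (beta y * C1 - alpha y))
      with (beta x * C1 - beta y * C1 + - (alpha x - alpha y)) by ring.
    apply Rle_trans with (1 := Rabs_triang _ _); rewrite Rabs_Ropp.
    generalize (La x y Hx Hy) (Lb x y Hx Hy); unfold L; lra.
  - apply Hwide; [lra|assumption|assumption]. }
assert (HFlow : forall x, In_w x -> M <= x -> km / 2 * s ^ 2 <= F C1 alpha beta x).
{ intros x Hx HxM; destruct (Fg x HxM) as [G1 _].
  destruct (Rpower_comparable z x gamma) as [G2 _]; [lra|apply Hwin, Hx|lra|].
  rewrite <- Hss in G2.
  assert (km * (s ^ 2 / 2) <= km * Rpower x gamma)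
    by (apply Rmult_le_compat_l; lra).
  lra. }
(* up to time [T], a characteristic moves by at most [T F = O(z^gamma)] *)
assert (HQ : forall y, z - 1 <= y <= z + 1 ->
          M <= y /\ 0 <= t <= G C1 M alpha beta y /\ M <= q y /\ In_w y /\ In_w (q y)).
{ intros y Hy.
  assert (HMy : M <= y) by lra.
  assert (HGy : T <= G C1 M alpha beta y) by (apply (G_le _ _ _ _ _ hr); lra).
  assert (Hty : 0 <= t <= G C1 M alpha beta y) by lra.
  destruct (Q_spec _ _ _ _ _ hr t y HMy Hty) as [Hq _]; fold q in Hq.
  assert (Hdisp := Q_displacement _ _ _ _ _ hr t y HMy Hty); fold q in Hdisp.
  destruct (Fg y HMy) as [_ G1].
  destruct (Rpower_comparable z y gamma) as [_ G2]; try lra.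
  rewrite <- Hss in G2.
  assert (G3 : F C1 alpha beta y <= kp * (2 * s ^ 2)).
  { apply Rle_trans with (1 := G1), Rmult_le_compat_l; lra. }
  assert (HFy := F_gt_0 _ _ _ _ _ hr y HMy).
  assert (G4 : t * F C1 alpha beta y <= T * (kp * (2 * s ^ 2))).
  { apply Rmult_le_compat; lra. }
  assert (0 <= W0 * s ^ 2) by (apply Rmult_le_pos; lra).
  assert (W0 * s ^ 2 = T * (kp * (2 * s ^ 2))) by (unfold W0; ring).
  unfold In_w; repeat split; lra. }
destruct (HQ z ltac:(lra)) as [Mz [Tz [Mq [Wz Wq]]]].
destruct (HQ (z - 1) ltac:(lra)) as [Mzm [Tzm [Mqm [Wzm Wqm]]]].
destruct (HQ (z + 1) ltac:(lra)) as [Mzp [Tzp [Mqp [Wzp Wqp]]]].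
assert (Hm0 : 0 < km / 2 * s ^ 2) by (apply Rmult_lt_0_compat; lra).
assert (Hinc : forall x, km / 2 * s ^ 2 * Rabs (x - 1) <= K1 ->
          s ^ 2 * Rabs (x - 1) <= K2).
{ intros x Hx; apply Rmult_le_reg_l with (km / 2); [lra|].
  replace (km / 2 * K2) with K1 by (unfold K2; field; lra); lra. }
assert (Hhp : s ^ 2 * Rabs (q (z + 1) - q z - 1) <= K2).
{ apply Hinc.
  apply (ratio_near_1 _ (F C1 alpha beta (q z)) (F C1 alpha beta (z + 1))
           (F C1 alpha beta (q (z + 1))) (F C1 alpha beta z)); auto.
  assert (H := Q_increment_space _ _ _ _ _ hr t z (z + 1) Mz ltac:(lra) Tz).
  fold q in H; replace (z + 1 - z) with 1 in H by ring.
  rewrite !Rmult_1_l in H; exact H. }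
assert (Hhm : s ^ 2 * Rabs (q (z - 1) - q z + 1) <= K2).
{ replace (q (z - 1) - q z + 1) with (- (q z - q (z - 1) - 1)) by ring.
  rewrite Rabs_Ropp; apply Hinc.
  apply (ratio_near_1 _ (F C1 alpha beta (q (z - 1))) (F C1 alpha beta z)
           (F C1 alpha beta (q z)) (F C1 alpha beta (z - 1))); auto.
  assert (H := Q_increment_space _ _ _ _ _ hr t (z - 1) z Mzm ltac:(lra) Tzm).
  fold q in H; replace (z - (z - 1)) with 1 in H by ring.
  rewrite !Rmult_1_l in H; exact H. }
assert (HK2s : forall x, s ^ 2 * Rabs x <= K2 -> Rabs x <= K2).
{ intros x Hx; assert (Hax := Rabs_pos x).
  assert (1 * Rabs x <= s ^ 2 * Rabs x) by (apply Rmult_le_compat_r; lra).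
  lra. }
assert (Habshp : Rabs (q (z + 1) - q z) <= 1 + K2).
{ replace (q (z + 1) - q z) with (1 + (q (z + 1) - q z - 1)) by ring.
  apply Rabs_plus_le; [rewrite Rabs_R1; lra|auto]. }
assert (Habshm : Rabs (q (z - 1) - q z) <= 1 + K2).
{ replace (q (z - 1) - q z) with (- 1 + (q (z - 1) - q z + 1)) by ring.
  apply Rabs_plus_le; [rewrite Rabs_left; lra|auto]. }
(* the weights [x^(gamma/2)] on the window are at least [s / 2] *)
assert (HD : forall x, In_w x ->
   Rabs (d 0%nat 0%nat t x) <= K /\ s * Rabs (d 0%nat 1%nat t x) <= 2 * K /\
   s ^ 2 * Rabs (d 0%nat 2%nat t x) <= 4 * K /\
   s ^ 3 * Rabs (d 0%nat 3%nat t x) <= 8 * K).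
{ intros x Hx; assert (Hx' := Hwin x Hx).
  destruct (Hdec t x ltac:(lra) ltac:(lra)) as [D0 [D1 [D2 D3]]].
  destruct (Rpower_comparable z x (gamma / 2)) as [G1 _]; try lra.
  fold s in G1.
  assert (Hpw : forall k v, Rpower x (gamma / 2) ^ k * Rabs v <= K ->
            s ^ k * Rabs v <= 2 ^ k * K).
  { intros k v Hv.
    apply Rle_trans with ((2 * Rpower x (gamma / 2)) ^ k * Rabs v).
    - apply Rmult_le_compat_r; [apply Rabs_pos|]; apply pow_incr; lra.
    - rewrite Rpow_mult_distr, Rmult_assoc.
      apply Rmult_le_compat_l; [apply pow_le; lra|exact Hv]. }
  split; [exact D0|]; split; [|split].
  - generalize (Hpw 1%nat (d 0%nat 1%nat t x)); rewrite !pow_1; auto.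
  - replace (4 * K) with (2 ^ 2 * K) by ring; auto.
  - replace (8 * K) with (2 ^ 3 * K) by ring; auto. }
assert (Hs3 : 0 < s ^ 3) by (apply pow_lt; lra).
assert (HTay : forall y, In_w y -> Rabs (y - q z) <= 1 + K2 ->
  exists e, d 0%nat 0%nat t y
    = d 0%nat 0%nat t (q z) + d 0%nat 1%nat t (q z) * (y - q z)
      + d 0%nat 2%nat t (q z) * (y - q z) ^ 2 / 2 + e
    /\ s ^ 3 * Rabs e <= H3).
{ intros y Hy Hyq.
  destruct (Taylor_second_order (fun k => d 0%nat k t) (q z) (y - q z)
              (8 * K / s ^ 3)) as [e [He1 He2]].
  - intros k u; apply (proj2 hd 0%nat k); lra.
  - intros u Hu; replace (q z + (y - q z)) with y in Hu by ring.
    assert (Hwu : In_w u).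
    { revert Hu; unfold In_w, Rmin, Rmax in *.
      destruct (Rle_dec (q z) y); lra. }
    destruct (HD u Hwu) as [_ [_ [_ D3]]].
    apply Rmult_le_reg_l with (s ^ 3); [exact Hs3|].
    replace (s ^ 3 * (8 * K / s ^ 3)) with (8 * K) by (field; lra); exact D3.
  - exists e; split.
    + replace (q z + (y - q z)) with y in He1 by ring; exact He1.
    + apply Rle_trans with (s ^ 3 * (8 * K / s ^ 3 * (1 + K2) ^ 3)).
      * apply Rmult_le_compat_l; [lra|]; apply Rle_trans with (1 := He2).
        apply Rmult_le_compat_l; [apply Rdiv_le_0_compat; lra|].
        apply pow_incr; split; [apply Rabs_pos|exact Hyq].
      * right; unfold H3; field; lra. }
destruct (HTay _ Wqm Habshm) as [em [Em Hem]].
destruct (HTay _ Wqp Habshp) as [ep [Ep Hep]].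
destruct (HD (q z) Wq) as [D0 [D1 [D2 _]]].
assert (Hpde : d 1%nat 0%nat t (q z)
  = 1 / 2 * (beta (q z) * C1 + alpha (q z)) * d 0%nat 2%nat t (q z)).
{ rewrite (partials_pde _ _ _ _ hc hd) by lra.
  rewrite (sigma_sqr _ _ _ _ _ _ _ _ hs) by exact Mq; reflexivity. }
rewrite Hpde; unfold F.
assert (Hm1 : Rabs (z - 1 - z) <= 1) by (apply Rabs_le; lra).
assert (Hp1 : Rabs (z + 1 - z) <= 1) by (apply Rabs_le; lra).
apply (remainder_algebra Kf s _ _ _ _ _ em ep
         (q (z - 1) - q z) (q (z + 1) - q z));
  unfold Kf; try lra; try assumption.
- rewrite Rabs_mult, (Rabs_pos_eq C1) by exact HC1.
  apply Rle_trans with (Ab * s ^ 2 * C1).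
  + apply Rmult_le_compat_r; [exact HC1|]; apply Bb0; lra.
  + replace (Ab * s ^ 2 * C1) with (Ab * C1 * s ^ 2) by ring.
    apply Rmult_le_compat_r; lra.
- apply Rle_trans with (Aa * s ^ 2); [apply Ba0; lra|].
  apply Rmult_le_compat_r; lra.
- generalize (Lb _ _ Wzm Wq) (Hwide _ _ _ HkB Wzm Wq); lra.
- generalize (La _ _ Wzp Wq) (Hwide _ _ _ HkA Wzp Wq); lra.
- apply Rle_trans with (s * (Ab * C1 * (s ^ 2 / z) * Rabs (z - 1 - z))).
  + apply Rmult_le_compat_l; [lra|]; apply Lb; assumption.
  + generalize (Hstep _ _ _ HkB Hm1); lra.
- apply Rle_trans with (s * (Aa * (s ^ 2 / z) * Rabs (z + 1 - z))).
  + apply Rmult_le_compat_l; [lra|]; apply La; assumption.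
  + generalize (Hstep _ _ _ HkA Hp1); lra.
Qed.

(** * The remainder for all indices *)

Lemma continuous_on_segment_bounded : forall (T : R) (f : R -> R),
  0 <= T -> continuous_on (segment 0 T) f ->
  exists B, forall t, segment 0 T t -> Rabs (f t) <= B.
Proof.
intros T f HT Cf.
pose (clamp := fun t => Rmax 0 (Rmin t T)).
assert (Hcl : forall t, segment 0 T (clamp t)).
{ intros t; split; [apply Rmax_l|]; apply Rmax_lub; [exact HT|apply Rmin_r]. }
assert (Hid : forall t, segment 0 T t -> clamp t = t).
{ intros t [H1 H2]; unfold clamp; rewrite Rmin_left, Rmax_right; lra. }
assert (Hlip : forall s t, Rabs (clamp s - clamp t) <= Rabs (s - t)).
{ intros s t; unfold clamp, Rmax, Rmin.
  destruct (Rle_dec s T) as [h1|h1], (Rle_dec t T) as [h2|h2];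
    repeat match goal with |- context [Rle_dec ?x ?y] =>
      let h := fresh in destruct (Rle_dec x y) as [h|h];
      try apply Rnot_le_lt in h end;
    try apply Rnot_le_lt in h1; try apply Rnot_le_lt in h2;
    unfold Rabs; repeat destruct Rcase_abs; lra. }
destruct (continuity_ab_maj (fun t => Rabs (f (clamp t))) 0 T HT) as [m [Hm _]].
- intros t _; apply continuity_pt_filterlim.
  apply filterlim_comp with (f := fun t => f (clamp t)) (g := Rabs)
    (G := locally (f (clamp t))); [|apply (continuous_Rabs (f (clamp t)))].
  intros P HP; specialize (Cf _ (Hcl t) P HP).
  apply within_locally_R in Cf; destruct Cf as [e [He Cf]].
  exists (mkposreal e He); intros s Hs.
  apply Cf; [apply Hcl|].
  apply Rle_lt_trans with (1 := Hlip s t), Hs.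
- exists (Rabs (f (clamp m))); intros t Ht.
  generalize (Hm t Ht); rewrite (Hid t Ht); auto.
Qed.

(** Bounds for each index, uniform from some rank on, are uniform. *)
Lemma eventual_uniform_bound : forall (P : nat -> R -> Prop),
  (forall n B B', P n B -> B <= B' -> P n B') ->
  (forall n, exists B, P n B) ->
  (exists B N, forall n, (N <= n)%nat -> P n B) ->
  exists B, 0 <= B /\ forall n, P n B.
Proof.
intros P Hmono Hex [B0 [N HN]].
assert (Hfin : forall m, exists B, forall n, (n < m)%nat -> P n B).
{ intros m; induction m as [|m [B IH]]; [exists 0; intros n Hn; lia|].
  destruct (Hex m) as [B' HB']; exists (Rmax B B'); intros n Hn.
  destruct (Nat.eq_dec n m) as [->|Hne].
  - apply Hmono with (1 := HB'), Rmax_r.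
  - apply Hmono with B; [apply IH; lia|apply Rmax_l]. }
destruct (Hfin N) as [B HB].
exists (Rmax 0 (Rmax B B0)); split; [apply Rmax_l|]; intros n.
destruct (Nat.lt_ge_cases n N) as [Hn|Hn].
- apply Hmono with (1 := HB n Hn), Rle_trans with (2 := Rmax_r _ _), Rmax_l.
- apply Hmono with (1 := HN n Hn), Rle_trans with (2 := Rmax_r _ _), Rmax_r.
Qed.

Theorem theorem13
  (C1 gamma M : R) (alpha beta sigma sigma0 sigmab c0 : R -> R)
  (c : R -> R -> R) (n0 : nat)
  (hC1 : 0 <= C1)
  (hrates : rates_assumption C1 gamma M alpha beta)
  (hsigma : diffusion_assumption C1 gamma M alpha beta sigma sigma0 sigmab)
  (hc0 : initial_assumption sigma0 c0)
  (hc : bounded_smooth_solution sigma c0 c)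
  (hn0 : M <= INR n0) :
  let tstar := G C1 M alpha beta (INR n0) in
  let Ch := Chat C1 M alpha beta c in
  (forall n : nat, (n0 <= n)%nat -> smooth_on (segment 0 tstar) (Ch n)) /\
  exists K : R -> R,
    (forall t, 0 <= t -> 0 <= K t) /\
    continuous_on Rplus_set K /\
    exists Rem : nat -> R -> R,
      forall n : nat, (n0 + 1 <= n)%nat ->
        continuous_on (segment 0 tstar) (Rem n) /\
        forall t, 0 <= t <= tstar ->
          is_derive_on (segment 0 tstar) (Ch n) t
            (beta (INR (n - 1)) * Ch (n - 1)%nat t * C1
             - (beta (INR n) * C1 + alpha (INR n)) * Ch n t
             + alpha (INR (n + 1)) * Ch (n + 1)%nat t
             + Rem n t) /\
          Rabs (Rem n t) <= K t / Rpower (INR n) (gamma / 2).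
Proof.
intros tstar Ch.
destruct (solution_smooth _ _ _ hc) as [d hd]; change (partials c d) in hd.
assert (Hts : 0 <= tstar) by (apply (G_ge_0 _ _ _ _ _ hrates); exact hn0).
assert (Hn : forall n, (n0 <= n)%nat -> M <= INR n /\ tstar <= G C1 M alpha beta (INR n)).
{ intros n Hn; apply le_INR in Hn; split; [lra|].
  apply (G_le _ _ _ _ _ hrates); lra. }
assert (Hder : forall n, (n0 <= n)%nat -> exists e : nat -> R -> R,
  (forall t, segment 0 tstar t -> e 0%nat t = Ch n t) /\
  (forall t, segment 0 tstar t ->
     e 1%nat t = d 1%nat 0%nat t (Q C1 M alpha beta t (INR n))
       - F C1 alpha beta (Q C1 M alpha beta t (INR n))
         * d 0%nat 1%nat t (Q C1 M alpha beta t (INR n))) /\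
  (forall k t, segment 0 tstar t ->
     is_derive_on (segment 0 tstar) (e k) t (e (S k) t))).
{ intros n Hle; destruct (Hn n Hle) as [G1 G2].
  apply (characteristic_derivatives C1 gamma M alpha beta hrates c d hd
           tstar (INR n) G1 G2). }
split.
{ intros n Hle; destruct (Hder n Hle) as [e [E0 [_ E2]]].
  exists e; split; assumption. }
pose (V := fun n t => d 1%nat 0%nat t (Q C1 M alpha beta t (INR n))
       - F C1 alpha beta (Q C1 M alpha beta t (INR n))
         * d 0%nat 1%nat t (Q C1 M alpha beta t (INR n))).
pose (Rem := fun n t => V n t
  - (beta (INR (n - 1)) * Ch (n - 1)%nat t * C1
     - (beta (INR n) * C1 + alpha (INR n)) * Ch n t
     + alpha (INR (n + 1)) * Ch (n + 1)%nat t)).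
assert (CCh : forall n t, (n0 <= n)%nat -> segment 0 tstar t ->
  filterlim (Ch n) (within (segment 0 tstar) (locally t)) (locally (Ch n t))).
{ intros n t Hle Ht; destruct (Hder n Hle) as [e [E0 [_ E2]]].
  apply is_derive_on_continuous with (e 1%nat t); [exact Ht|].
  apply is_derive_on_ext with (e 0%nat); auto. }
assert (CV : forall n t, (n0 <= n)%nat -> segment 0 tstar t ->
  filterlim (V n) (within (segment 0 tstar) (locally t)) (locally (V n t))).
{ intros n t Hle Ht; destruct (Hder n Hle) as [e [_ [E1 E2]]].
  apply is_derive_on_continuous with (e 2%nat t); [exact Ht|].
  apply is_derive_on_ext with (e 1%nat); auto. }
assert (CRem : forall n, (n0 + 1 <= n)%nat -> continuous_on (segment 0 tstar) (Rem n)).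
{ intros n Hle t Ht.
  assert (Hlin : forall k m, (n0 <= m)%nat ->
    filterlim (fun s => k * Ch m s) (within (segment 0 tstar) (locally t))
              (locally (k * Ch m t))).
  { intros k m Hm; apply filterlim_within_mult; [apply filterlim_const|].
    apply CCh; assumption. }
  apply filterlim_ext with (fun s => V n s
    + ((- (beta (INR (n - 1)) * C1)) * Ch (n - 1)%nat s
       + ((beta (INR n) * C1 + alpha (INR n)) * Ch n s
          + (- alpha (INR (n + 1))) * Ch (n + 1)%nat s))).
  { intros s; unfold Rem; ring. }
  replace (Rem n t) with (V n t
    + ((- (beta (INR (n - 1)) * C1)) * Ch (n - 1)%nat t
       + ((beta (INR n) * C1 + alpha (INR n)) * Ch n t
          + (- alpha (INR (n + 1))) * Ch (n + 1)%nat t)))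
    by (unfold Rem; ring).
  apply filterlim_within_plus; [apply CV; [lia|exact Ht]|].
  apply filterlim_within_plus; [apply Hlin; lia|].
  apply filterlim_within_plus; apply Hlin; lia. }
destruct (eventual_uniform_bound (fun n B => (n0 + 1 <= n)%nat ->
   forall t, segment 0 tstar t -> Rpower (INR n) (gamma / 2) * Rabs (Rem n t) <= B))
  as [K [HK HB]].
- intros n B B' H HBB Hle t Ht; specialize (H Hle t Ht); lra.
- intros n; destruct (Compare_dec.le_dec (n0 + 1) n) as [Hle|Hnle];
    [|exists 0; intros H; contradiction].
  destruct (continuous_on_segment_bounded tstar (Rem n) Hts (CRem n Hle)) as [B HB].
  exists (Rpower (INR n) (gamma / 2) * B); intros _ t Ht.
  apply Rmult_le_compat_l; [apply Rlt_le, exp_pos|auto].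
- destruct (large_index_remainder C1 gamma M (INR n0) alpha beta sigma sigma0
              sigmab c0 c d hC1 hrates hsigma hc0 hc hd hn0) as [K [N HK]].
  destruct (nfloor_ex (Rabs N) (Rabs_pos N)) as [m [_ Hm]].
  exists K, (S m); intros n Hnm Hle t Ht.
  assert (HnN : N <= INR n).
  { apply le_INR in Hnm; rewrite S_INR in Hnm; generalize (Rle_abs N); lra. }
  assert (Hn1 : INR n0 + 1 <= INR n).
  { apply le_INR in Hle; rewrite plus_INR in Hle; simpl in Hle; lra. }
  specialize (HK (INR n) t HnN Hn1 Ht); simpl in HK.
  replace (INR n - 1) with (INR (n - 1)) in HK
    by (rewrite minus_INR by lia; reflexivity).
  replace (INR n + 1) with (INR (n + 1)) in HK
    by (rewrite plus_INR; reflexivity).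
  rewrite !(proj1 hd) in HK by apply Ht.
  unfold Rem, V, Ch, Chat.
  rewrite (Rmult_assoc (beta (INR (n - 1)))), (Rmult_comm _ C1), <- Rmult_assoc.
  exact HK.
(* the time interval being fixed, a constant function suffices *)
- exists (fun _ => K); split; [auto|]; split.
  + intros t _; apply filterlim_const.
  + exists Rem; intros n Hle; split; [apply CRem, Hle|]; intros t Ht; split.
    * destruct (Hder n ltac:(lia)) as [e [E0 [E1 E2]]].
      apply is_derive_on_ext with (e 0%nat); [exact Ht|exact E0|].
      match goal with |- is_derive_on _ _ _ ?l => replace l with (e 1%nat t) end.
      -- apply E2, Ht.
      -- rewrite E1 by exact Ht; unfold Rem, V; ring.
    * assert (Hp : 0 < Rpower (INR n) (gamma / 2)) by apply exp_pos.
      apply Rmult_le_reg_l with (Rpower (INR n) (gamma / 2)); [exact Hp|].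
      replace (Rpower (INR n) (gamma / 2) * (K / Rpower (INR n) (gamma / 2)))
        with K by (field; lra).
      apply HB; assumption.
Qed.
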